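(* Let $X_1,X_2,\ldots,X_n$ be i.i.d. $\Omega$-valued random variables with distribution $F$, let $N(\cdot)$ be a proximity map on $\Omega$, let $D_n$ be the associated vertex-random proximity catch digraph (PCD), and let $G_{\text{and}}(D_n)$ be its reflexivity graph. The relative edge density $\rho_{\text{and}}(D_n)$ of $G_{\text{and}}(D_n)$ is a one-sample $U$-statistic of degree 2 and is an unbiased estimator of $p_{\text{and}}(N)$. If, additionally, $\nu_{\text{and}}(N):=\mathbf{Cov}[h^{\text{and}}_{ij},h^{\text{and}}_{ik}]>0$ for all distinct $i,j,k\in\{1,2,\ldots,n\}$, then $$\sqrt n\,\bigl[\rho_{\text{and}}(D_n)-p_{\text{and}}(N)\bigr]\stackrel{\mathcal L}{\longrightarrow}\mathcal N(0,4\,\nu_{\text{and}}(N))\quad\text{as } n\to\infty .$$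
   Context: $(\Omega,\mathcal M)$ is a measurable space. A proximity map is a map $N:\Omega\to\mathcal P(\Omega)$ (with $\mathcal P$ the power set) associating with each $x\in\Omega$ a proximity region $N(x)\subseteq\Omega$ (in the paper, $N(x)$ is defined in terms of the distance between $x$ and a given set $\mathcal Y_m\subset\Omega$); events involving $N$ are assumed measurable. Its $\Gamma_1$-region is $\Gamma_1(x,N)=\{z\in\Omega: x\in N(z)\}$. The PCD $D_n$ has vertex set $\mathcal V=\{X_1,\ldots,X_n\}$ and arc set $\mathcal A$ given by $(X_i,X_j)\in\mathcal A\iff X_j\in N(X_i)$ for $i\neq j$. The reflexivity graph $G_{\text{and}}(D_n)=(\mathcal V,\mathcal E_{\text{and}})$ has $X_iX_j\in\mathcal E_{\text{and}}$ iff $(X_i,X_j)\in\mathcal A$ and $(X_j,X_i)\in\mathcal A$, equivalently $X_j\in N(X_i)\cap\Gamma_1(X_i,N)$. Its relative edge density is $\rho_{\text{and}}(D_n)=2|\mathcal E_{\text{and}}|/(n(n-1))$. Put $h^{\text{and}}_{ij}=\mathbf I(X_j\in N(X_i)\cap\Gamma_1(X_i,N))$ and $p_{\text{and}}(N)=P(X_j\in N(X_i)\cap\Gamma_1(X_i,N))$ for $i\neq j$. $\stackrel{\mathcal L}{\longrightarrow}$ is convergence in law and $\mathcal N(\mu,\sigma^2)$ the normal distribution with mean $\mu$ and variance $\sigma^2$. *)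

(* Defs.v *)
From HB Require Import structures.
From mathcomp Require Import all_boot all_order all_algebra all_fingroup.
From mathcomp Require Import finmap.
From mathcomp Require Import all_classical all_reals all_analysis.

Set Implicit Arguments.
Unset Strict Implicit.
Unset Printing Implicit Defensive.

Import Order.TTheory GRing.Theory Num.Theory.
Import numFieldNormedType.Exports.

Local Open Scope classical_set_scope.
Local Open Scope ring_scope.

Section ProximityCatchDigraph.
Context {Omega : Type}.

Definition proximity_map := Omega -> set Omega.

Definition Gamma1 (N : proximity_map) (x : Omega) : set Omega :=
  [set z | N z x].

(* The vertices are the labels i of the points x i, so that coinciding points
   still give distinct vertices. *)
Definition pcd (N : proximity_map) n (x : 'I_n -> Omega) : rel 'I_n :=
  fun i j => (i != j) && `[< N (x i) (x j) >].

End ProximityCatchDigraph.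
Arguments proximity_map : clear implicits.

Definition and_edges (V : finType) (arc : rel V) : {set {set V}} :=
  [set e : {set V} | [exists i, exists j,
     [&& i != j, e == [set i; j]%SET, arc i j & arc j i]]].

Definition rel_edge_density (R : realType) n (E : {set {set 'I_n}}) : R :=
  2 * #|E|%:R / (n%:R * (n%:R - 1)).

Section SampleStatistics.
Context d d' (T : measurableType d) (Omega : measurableType d') (R : realType).
Variable P : probability T R.
Implicit Types (X : nat -> {RV P >-> Omega}) (N : proximity_map Omega).

Definition mutually_independent X :=
  forall (J : {fset nat}) (A : nat -> set Omega),
    (forall i, measurable (A i)) ->
    (P (\bigcap_(i in [set` J]) (X i @^-1` A i)) =
     \prod_(i <- J) P (X i @^-1` A i))%E.

Definition iid X (F : probability Omega R) :=
  mutually_independent X /\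
  forall i A, measurable A -> distribution P (X i) A = F A.

Definition Ustat m (g : m.-tuple Omega -> R) n (x : 'I_n -> Omega) : R :=
  ('C(n, m)%:R)^-1 *
  \sum_(c : m.-tuple 'I_n | sorted ltn (map val c)) g (map_tuple x c).

Definition one_sample_Ustatistic X (m : nat) (S : nat -> T -> R) :=
  exists g : m.-tuple Omega -> R,
    [/\ measurable_fun [set: m.-tuple Omega] g,
        forall (s : 'S_m) t, g [tuple tnth t (s i) | i < m] = g t,
        P.-integrable [set: T] (fun w => (g [tuple X i w | i < m])%:E)
      & forall n w, (m <= n)%N -> S n w = Ustat g (fun i : 'I_n => X i w)].

Definition cvg_in_law (Y : nat -> T -> R)
    (mu : probability (measurableTypeR R) R) :=
  (forall n, measurable_fun [set: T] (Y n)) /\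
  forall t : R, {for t, continuous (fun u : R => mu [set` `]-oo, u]])} ->
    P [set w | Y n w <= t] @[n --> \oo] --> mu [set` `]-oo, t]].

Definition rho_and X N (n : nat) (w : T) : R :=
  rel_edge_density R (and_edges (pcd N (fun i : 'I_n => X i w))).

Definition h_and X N (i j : nat) (w : T) : R :=
  \1_(N (X i w) `&` Gamma1 N (X i w)) (X j w).

Definition p_and X N (i j : nat) : R :=
  fine (P [set w | (N (X i w) `&` Gamma1 N (X i w)) (X j w)]).

Definition nu_and X N (i j k : nat) : R :=
  fine (covariance P (h_and X N i j) (h_and X N i k)).

End SampleStatistics.

(* Main.v *)
Require Import Defs.
From HB Require Import structures.
From mathcomp Require Import all_boot all_order all_algebra all_fingroup.
From mathcomp Require Import finmap.
From mathcomp Require Import all_classical all_reals all_analysis.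
From mathcomp Require Import measurable_realfun ring lra.

Import Order.TTheory GRing.Theory Num.Theory.
Import numFieldNormedType.Exports.

Local Open Scope classical_set_scope.
Local Open Scope ring_scope.

(** A U-statistic of degree 2 is, up to a remainder that is negligible at the
scale 1 / sqrt n, a normalized sum of i.i.d. variables, and for such sums the
central limit theorem holds.

Writing [H] for the 0/1 kernel that says that two points lie in each other's
proximity regions, the relative edge density is the average of [H] over the
ordered pairs of distinct vertices ([card_and_edges], [rho_and_average]), which
gives the U-statistic and, by linearity, the unbiasedness.  Subtracting from
[H] its mean and its two conditional expectations leaves a kernel [residual]
with vanishing conditional expectations.  Residual terms of different pairs
are therefore uncorrelated, so their sum has a second moment of order n^2
rather than n^4 ([residual_sum_second_moment]).  After division by n(n-1) and
multiplication by sqrt n only the sum of the i.i.d. variables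
[hajek (X k)] = 2 (E[H | X k] - p) survives ([hoeffding_decomposition]), and
the variance of [hajek] is 4 nu because nu is the variance of E[H | X k]
([expect_kernel2]).

The central limit theorem for bounded i.i.d. summands is obtained by Lindeberg's
telescoping, with the Gaussian distribution function itself as test function.
Let Phi be the distribution function of N(0, s^2).  The function
u(a, y) = Phi((t - y) / sqrt a) solves the heat equation, so that replacing
(a, y) by (a - 1/n, y + xi / sqrt n), for a centred xi of variance s^2, changes
the expectation of u by O(n^(-3/2)) only ([heat_step]).  Starting from
(1 + del^2, 0), after n steps one has compared E Phi((t - S_n / sqrt n) / del)
with Phi(t / sqrt (1 + del^2)) ([lindeberg]).  The estimates on u come from the
derivative of Phi and the decay of its density.  Letting del tend to 0, the
smoothed indicator Phi((t - y) / del) approaches the indicator of y <= t, which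
gives convergence in law ([cvg_in_law_normal]); as Phi is Lipschitz, a remainder
that is small in mean square disappears in the limit ([clt_remainder]).

Independence is used only through [freezing]: in an expectation, the variable
X i can be integrated out alone, the other ones being kept fixed. *)

(** * The Gaussian distribution function *)

(** Here [p] stands for the density at [x] and [t] for 1 + x^2 / (4 s^2), so
that the decay of the density is expressed by t^2 p <= pk: every power of
|x| up to the third is at most a multiple of t^2. *)
Lemma moment_bounds {R : realType} (s t p pk x : R) :
  0 < s -> 0 <= p -> 1 <= t -> x ^+ 2 = 4 * s ^+ 2 * (t - 1) -> t ^+ 2 * p <= pk ->
  let K := pk * (1 + s + 4 * s ^+ 2 + 4 * s ^+ 3) in
  [/\ p <= K, `|x| * p <= K, x ^+ 2 * p <= K & `|x| ^+ 3 * p <= K].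
Proof.
move=> s_gt0 p0 t1 tE tp K.
have xt : `|x| <= s * t.
  have -> : s * t = `|x| + (`|x| - 2 * s) ^+ 2 / (4 * s).
    have -> : (`|x| - 2 * s) ^+ 2 = x ^+ 2 - 4 * s * `|x| + 4 * s ^+ 2.
      by rewrite -(real_normK (num_real x)); ring.
    by rewrite tE; field; rewrite gt_eqF.
  by rewrite lerDl divr_ge0 ?sqr_ge0// mulr_ge0// ltW.
have t2 : t <= t ^+ 2 by rewrite expr2 ler_peMl// (le_trans _ t1).
have s20 : 0 < s ^+ 2 by rewrite exprn_gt0.
have s30 : 0 < s ^+ 3 by rewrite exprn_gt0.
have main (c y : R) : 0 <= c -> c <= 1 + s + 4 * s ^+ 2 + 4 * s ^+ 3 ->
    y <= c * t ^+ 2 -> y * p <= K.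
  move=> c0 cle yc; apply: (@le_trans _ _ (c * t ^+ 2 * p)).
    by rewrite ler_wpM2r.
  by rewrite -mulrA mulrC ler_pM// mulr_ge0// sqr_ge0.
split.
- by rewrite -(mul1r p); apply: (main 1); lra.
- apply: (main s); [exact: ltW|lra|].
  by rewrite (le_trans xt)// ler_wpM2l// ltW.
- apply: (main (4 * s ^+ 2)); [lra|lra|].
  by rewrite tE ler_wpM2l; lra.
- apply: (main (4 * s ^+ 3)); [lra|lra|].
  rewrite exprS -normrX (ger0_norm (sqr_ge0 x)) tE.
  have -> : 4 * s ^+ 3 * t ^+ 2 = (s * t) * (4 * s ^+ 2 * t) by ring.
  rewrite ler_pM// ?mulr_ge0 ?ler_wpM2l//; lra.
Qed.

Section GaussianCdf.
Context {R : realType} (s : R).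
Hypothesis s_gt0 : 0 < s.
Let s_neq0 : s != 0. Proof. by rewrite gt_eqF. Qed.

Definition normal_cdf (x : R) : R := fine (normal_prob 0 s `]-oo, x]).
Local Notation Phi := normal_cdf.
Local Notation phi := (normal_pdf 0 s).

Lemma normal_cdf_ge0 x : 0 <= Phi x.
Proof. exact: fine_ge0. Qed.

Lemma normal_cdf_le1 x : Phi x <= 1.
Proof.
rewrite -lee_fin fineK ?fin_num_measure//.
exact: (@probability_le1 _ _ _ (normal_prob 0 s)).
Qed.

Lemma normal_cdf_homo : {homo Phi : x y / x <= y}.
Proof.
move=> x y xy; rewrite fine_le ?fin_num_measure// le_measure ?inE//.
by apply: subset_itvl; rewrite bnd_simp.
Qed.

Lemma is_derive_normal_cdf (x : R) : is_derive x (1 : R) Phi (phi x).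
Proof.
have fi : lebesgue_measure.-integrable `]-oo, (x + 1)]%classic (EFin \o phi).
  by apply: (integrableS _ _ (@subsetT _ _)) => //; exact: integrable_normal_pdf.
have xlt : x < x + 1 by rewrite ltrDl.
have := @continuous_FTC1 R phi -oo%O x (x + 1) xlt fi (ltNyr _)
  (continuous_normal_pdf s_neq0 (x:=x)).
rewrite -[X in derivable X _ _]/Phi -[X in derive1 X]/Phi derive1E => -[dF F'].
exact: DeriveDef dF F'.
Qed.

Lemma continuous_normal_cdf : continuous Phi.
Proof.
move=> x; apply/differentiable_continuous/derivable1_diffP.
by have [] := is_derive_normal_cdf x.
Qed.

Lemma is_derive_normal_pdf (x : R) : is_derive x (1 : R) phi (- (x / s ^+ 2 * phi x)).
Proof.
rewrite normal_pdfE// /normal_fun.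
have g' : is_derive x (1 : R) (fun y : R => - (y - 0) ^+ 2 / (s ^+ 2 *+ 2))
    (- (x / s ^+ 2)).
  have -> : (fun y : R => - (y - 0) ^+ 2 / (s ^+ 2 *+ 2)) =
    (fun y => (- (s ^+ 2 *+ 2)^-1) *: (y ^+ 2)).
    by apply/funext => y; rewrite subr0 /GRing.scale/= mulNr mulNr mulrC.
  apply: is_derive_eq; rewrite /GRing.scale/= mulr1.
  by rewrite -(mulr_natr (s ^+ 2)); field.
have e' := is_derive1_comp (f := expR)
  (g := fun y : R => - (y - 0) ^+ 2 / (s ^+ 2 *+ 2)) (is_derive_expR _) g'.
apply: is_derive_eq; rewrite /GRing.scale/= mulrN mulrN; congr (- _).
by ring.
Qed.

Let idR : measurableTypeR R -> R := idfun.

#[local] HB.instance Definition _ :=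
  @isMeasurableFun.Build _ _ _ _ idR (@measurable_id _ _ setT).

Lemma normal_cdf_cvgy : Phi x @[x --> +oo] --> (1 : R).
Proof.
have /fine_cvgP[_] := @cvg_cdfy1 _ _ R (normal_prob 0 s)
  (idR : {RV (normal_prob 0 s) >-> R}).
exact.
Qed.

Lemma normal_cdf_cvgNy : Phi x @[x --> -oo] --> (0 : R).
Proof.
have /fine_cvgP[_] := @cvg_cdfNy0 _ _ R (normal_prob 0 s)
  (idR : {RV (normal_prob 0 s) >-> R}).
exact.
Qed.

(** This is 1 + y <= exp y for y = x^2 / (4 s^2), squared. *)
Lemma normal_pdf_decay (x : R) :
  (1 + x ^+ 2 / (4 * s ^+ 2)) ^+ 2 * phi x <= normal_peak s.
Proof.
rewrite normal_pdfE// /normal_fun subr0.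
have -> : - x ^+ 2 / (s ^+ 2 *+ 2) = - (x ^+ 2 / (4 * s ^+ 2)) * 2.
  by rewrite -(mulr_natr (s ^+ 2)); field.
rewrite mulrCA expRM_natr expRN -exprMn ler_piMr ?normal_peak_ge0//.
have : 0 <= x ^+ 2 / (4 * s ^+ 2).
  exact: divr_ge0 (sqr_ge0 _) (mulr_ge0 (ler0n _ 4) (sqr_ge0 _)).
move: (x ^+ 2 / _) => y y0.
rewrite exprn_ile1 ?mulr_ge0 ?addr_ge0 ?invr_ge0 ?expR_ge0//.
by rewrite ler_pdivrMr ?expR_gt0// mul1r expR_ge1Dx.
Qed.

Lemma normal_pdf_moments : exists2 K, 0 < K & forall x : R,
  [/\ phi x <= K, `|x| * phi x <= K, x ^+ 2 * phi x <= K & `|x| ^+ 3 * phi x <= K].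
Proof.
have pk0 := normal_peak_gt0 s_neq0.
exists (normal_peak s * (1 + s + 4 * s ^+ 2 + 4 * s ^+ 3)).
  by rewrite mulr_gt0// !addr_gt0// mulr_gt0// exprn_gt0.
move=> x; apply: (@moment_bounds _ _ (1 + x ^+ 2 / (4 * s ^+ 2))) => //.
- exact: normal_pdf_ge0.
- by rewrite lerDl; exact: divr_ge0 (sqr_ge0 _) (mulr_ge0 (ler0n _ 4) (sqr_ge0 _)).
- by field.
- exact: normal_pdf_decay.
Qed.

End GaussianCdf.

(** The closed ball around [a] is the right domain for an iterated use: bounding
the derivative on it by the same lemma yields Taylor remainders. *)
Lemma mean_value_le {R : realType} (f df : R -> R) (a b M : R) :
  (forall x, `|x - a| <= `|b - a| -> is_derive x (1 : R) f (df x)) ->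
  (forall x, `|x - a| <= `|b - a| -> `|df x| <= M) ->
  `|f b - f a| <= M * `|b - a|.
Proof.
move=> dfx dfM.
have cont u v : (forall x, x \in `[u, v] -> `|x - a| <= `|b - a|) ->
   {within `[u, v], continuous f}.
  move=> h; apply: derivable_within_continuous => x /h /dfx; by case.
have [ab|ba] := leP a b.
  have sub x : x \in `[a, b] -> `|x - a| <= `|b - a|.
    rewrite in_itv/= => /andP[ax xb].
    by rewrite !ger0_norm ?subr_ge0// lerB.
  have [|c /sub cab ->] := @MVT_segment _ f df a b ab _ (cont _ _ sub).
    by move=> x /subset_itv_oo_cc /sub /dfx.
  by rewrite normrM ler_wpM2r// dfM.
have sub x : x \in `[b, a] -> `|x - a| <= `|b - a|.
  rewrite in_itv/= => /andP[ax xb].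
  by rewrite !ler0_norm ?subr_le0// ?(ltW ba)// lerN2 lerB.
have [|c /sub cab e] := @MVT_segment _ f df b a (ltW ba) _ (cont _ _ sub).
  by move=> x /subset_itv_oo_cc /sub /dfx.
by rewrite distrC e normrM (distrC a) ler_wpM2r// dfM.
Qed.

Section HeatStep.
Context {R : realType} (s : R).
Hypothesis s_gt0 : 0 < s.
Let s_neq0 : s != 0. Proof. by rewrite gt_eqF. Qed.
Local Notation Phi := (normal_cdf s).
Local Notation phi := (normal_pdf 0 s).

Lemma normal_cdf_lipschitz : exists2 K, 0 < K & forall x y : R,
  `|Phi x - Phi y| <= K * `|x - y|.
Proof.
have [K K0 mK] := normal_pdf_moments s s_gt0; exists K => // x y.
apply: (mean_value_le Phi phi) => z _; first exact: is_derive_normal_cdf.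
by rewrite ger0_norm ?normal_pdf_ge0//; have [] := mK z.
Qed.

Let is_derive_affine (z x : R) : is_derive x (1 : R) (fun y => z - y) (- 1).
Proof. by apply: is_derive_eq; rewrite add0r mul1r. Qed.

(* The second derivative of the distribution function. *)
Let dphi (z : R) := - (z / s ^+ 2 * phi z).

Let is_derive_dphi (x : R) :
  is_derive x (1 : R) dphi ((x ^+ 2 / s ^+ 4 - (s ^+ 2)^-1) * phi x).
Proof.
have -> : dphi = (fun z => (- (s ^+ 2)^-1) *: (z * phi z)).
  by apply/funext => z; rewrite /dphi /GRing.scale/=; ring.
have h := is_derive_normal_pdf s s_gt0 x.
apply: is_derive_eq; rewrite /GRing.scale/=.
by field.
Qed.

(** Taylor's formula of order two in space: the second derivative of Phi is
- (z / s^2) phi z, the third one is bounded, and integrating a bound three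
times from 0 gives the cubic remainder. *)
Lemma normal_cdf_taylor : exists2 C, 0 < C & forall z b : R,
  `|Phi (z - b) - Phi z + b * phi z + b ^+ 2 / 2 * (z / s ^+ 2 * phi z)|
    <= C * `|b| ^+ 3.
Proof.
have [K K0 mK] := normal_pdf_moments s s_gt0.
pose C := K / s ^+ 4 + K / s ^+ 2.
have s2 : 0 < s ^+ 2 by rewrite exprn_gt0.
have s4 : 0 < s ^+ 4 by rewrite exprn_gt0.
have C0 : 0 < C by rewrite addr_gt0// divr_gt0.
exists C => // z b.
have d3 (x : R) : `|- ((x ^+ 2 / s ^+ 4 - (s ^+ 2)^-1) * phi x)| <= C.
  have [h1 _ h2 _] := mK x.
  have p0 := normal_pdf_ge0 0 s x.
  have i4 : 0 <= (s ^+ 4)^-1 by rewrite invr_ge0 ltW.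
  have i2 : 0 <= (s ^+ 2)^-1 by rewrite invr_ge0 ltW.
  rewrite normrN mulrBl (le_trans (ler_normB _ _))//.
  rewrite (ger0_norm (mulr_ge0 (mulr_ge0 (sqr_ge0 x) i4) p0)).
  rewrite (ger0_norm (mulr_ge0 i2 p0)).
  apply: lerD; first by rewrite mulrAC ler_wpM2r.
  by rewrite mulrC ler_wpM2r.
have d2 (x : R) : `|dphi (z - x) - dphi z| <= C * `|x|.
  have /(_ 0 x) := @mean_value_le _ (fun y => dphi (z - y))
    (fun y => - (((z - y) ^+ 2 / s ^+ 4 - (s ^+ 2)^-1) * phi (z - y))).
  move=> /(_ C); rewrite !subr0; apply => y _ //.
  have := is_derive1_comp (f := dphi) (is_derive_dphi _) (is_derive_affine z y).
  by rewrite mulrN1.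
pose q1 (x : R) := phi z - phi (z - x) - x * dphi z.
have d1 (x : R) : `|q1 x| <= C * `|x| ^+ 2.
  have := @mean_value_le _ q1 (fun y => dphi (z - y) - dphi z) 0 x (C * `|x|).
  rewrite !subr0 {3}/q1 subr0 mul0r !subrr !subr0 expr2 mulrA.
  apply => y; rewrite subr0 => yx.
    have h := is_derive1_comp (f := phi) (is_derive_normal_pdf s s_gt0 _)
      (is_derive_affine z y).
    apply: is_derive_eq.
    by rewrite /dphi /GRing.scale/= !mulr0 !mulr1; ring.
  by apply: (le_trans (d2 y)); rewrite ler_wpM2l ?(ltW C0).
pose q0 (x : R) := Phi (z - x) - Phi z + x * phi z - x ^+ 2 / 2 * dphi z.
have := @mean_value_le _ q0 q1 0 b (C * `|b| ^+ 2).
rewrite !subr0 {3}/q0 subr0 mul0r subrr expr0n /= !mul0r !addr0 !subr0.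
rewrite /q0 /dphi mulrN opprK -(mulrA C) -exprSr; apply => y; rewrite subr0 => yx.
  have h := is_derive1_comp (f := Phi) (is_derive_normal_cdf s s_gt0 _)
    (is_derive_affine z y).
  apply: is_derive_eq.
  by rewrite /q1 /dphi /GRing.scale/= !mulr0 !mulr1; field.
by apply: (le_trans (d1 y)); rewrite ler_wpM2l ?(ltW C0)// lerXn2r// nnegrE.
Qed.

(** Taylor's formula of order one in the scale, uniformly in [z].  The second
derivative in [c] is - c z^3 / s^2 phi (c z), and z^3 phi (c z) is bounded
because c stays away from 0. *)
Lemma normal_cdf_scale_taylor : exists2 C, 0 < C & forall z c : R, 2^-1 <= c <= 1 ->
  `|Phi (c * z) - Phi z - (c - 1) * (z * phi z)| <= C * (c - 1) ^+ 2.
Proof.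
have [K K0 mK] := normal_pdf_moments s s_gt0.
have s2 : 0 < s ^+ 2 by rewrite exprn_gt0.
pose C := 4 * (K / s ^+ 2).
have C0 : 0 < C by rewrite mulr_gt0// divr_gt0.
exists C => // z c /andP[c2 c1].
have near1 (x : R) : `|x - 1| <= `|c - 1| -> c <= x.
  by rewrite [leRHS]ler0_norm ?subr_le0// ler_norml => /andP[]; lra.
have dil (x : R) : is_derive x (1 : R) (fun y => y * z) z.
  have -> : (fun y => y * z) = (fun y => z *: y).
    by apply/funext => y; rewrite /GRing.scale/= mulrC.
  by apply: is_derive_eq; rewrite /GRing.scale/= mulr1.
pose q1 (x : R) := z * phi (x * z) - z * phi z.
have d1 (x : R) : `|x - 1| <= `|c - 1| -> `|q1 x| <= C * `|x - 1|.
  move=> xc.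
  have := @mean_value_le _ (fun y => z * phi (y * z))
    (fun y => z * (dphi (y * z) * z)) 1 x C.
  rewrite mul1r -/(q1 x); apply => y yx.
    have h := is_derive1_comp (f := phi) (is_derive_normal_pdf s s_gt0 _) (dil y).
    apply: is_derive_eq.
    by [].
  have cy : 2^-1 <= y by rewrite (le_trans c2)// near1// (le_trans yx).
  have y0 : 0 < y by apply: lt_le_trans cy; lra.
  have [_ _ _] := mK (y * z); set p := phi _ => hK.
  have p0 : 0 <= p by rewrite normal_pdf_ge0.
  rewrite /dphi -/p.
  have -> : z * (- (y * z / s ^+ 2 * p) * z) = - (y * z ^+ 3 * p / s ^+ 2) by ring.
  have i2 : 0 <= (s ^+ 2)^-1 by rewrite invr_ge0 ltW.
  rewrite normrN normrM (ger0_norm i2).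
  rewrite /C (mulrA 4) ler_wpM2r// normrM normrM normrX (ger0_norm p0) (gtr0_norm y0).
  move: hK; rewrite normrM (gtr0_norm y0) exprMn => hK.
  have z3 : 0 <= `|z| ^+ 3 by rewrite exprn_ge0.
  (* As y >= 1/2, the factor y is absorbed in the y^3 of |y z|^3. *)
  have : y <= 4 * y ^+ 3 by nra.
  move=> /(ler_wpM2r z3) /(ler_wpM2r p0) /le_trans; apply.
  by rewrite -(mulrA 4) -(mulrA 4) ler_wpM2l.
pose q0 (x : R) := Phi (x * z) - Phi z - (x - 1) * (z * phi z).
have := @mean_value_le _ q0 q1 1 c (C * `|c - 1|).
rewrite {3}/q0 mul1r !subrr mul0r !subr0.
rewrite /q0 -(mulrA C) -expr2 real_normK ?num_real//; apply => y yx.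
  have h := is_derive1_comp (f := Phi) (is_derive_normal_cdf s s_gt0 _) (dil y).
  apply: is_derive_eq.
  by rewrite /q1 /GRing.scale/=; ring.
by apply: (le_trans (d1 y yx)); rewrite ler_wpM2l ?(ltW C0).
Qed.

End HeatStep.

(** * Expectations of bounded measurable functions *)

(** All random variables met here are bounded; boundedness is stable under the
algebraic operations and yields integrability for every probability, which
removes the integrability conditions from the rules of integration. *)
Definition bounded_measurable {d} {T : measurableType d} {R : realType}
  (f : T -> R) := measurable_fun setT f /\ exists M, forall x, `|f x| <= M.

Section BoundedMeasurable.
Context {d} {T : measurableType d} {R : realType}.
Implicit Types f g : T -> R.
Local Notation bm := bounded_measurable.

Lemma bmeas_cst (r : R) : bm (fun _ : T => r).
Proof. by split => //; exists `|r|. Qed.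

Lemma bmeasD f g : bm f -> bm g -> bm (fun x => f x + g x).
Proof.
move=> [mf [M fM]] [mg [M' gM]]; split; first exact: measurable_funD.
by exists (M + M') => x; rewrite (le_trans (ler_normD _ _))// lerD.
Qed.

Lemma bmeasM f g : bm f -> bm g -> bm (fun x => f x * g x).
Proof.
move=> [mf [M fM]] [mg [M' gM]]; split; first exact: measurable_funM.
by exists (M * M') => x; rewrite normrM ler_pM.
Qed.

Lemma bmeas_sqr f : bm f -> bm (fun x => f x ^+ 2).
Proof.
move=> bf; have -> : (fun x => f x ^+ 2) = (fun x => f x * f x).
  by apply/funext => x; rewrite expr2.
exact: bmeasM.
Qed.

Lemma bmeasZ (r : R) f : bm f -> bm (fun x => r * f x).
Proof. exact/bmeasM/bmeas_cst. Qed.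

Lemma bmeasN f : bm f -> bm (fun x => - f x).
Proof.
move=> /(bmeasZ (-1)); have -> // : (fun x => -1 * f x) = fun x => - f x.
by apply/funext => x; rewrite mulN1r.
Qed.

Lemma bmeasB f g : bm f -> bm g -> bm (fun x => f x - g x).
Proof. by move=> bf /bmeasN; exact: bmeasD. Qed.

Lemma bmeas_sum I (r : seq I) (p : pred I) (f : I -> T -> R) :
  (forall i, p i -> bm (f i)) -> bm (fun x => \sum_(i <- r | p i) f i x).
Proof.
move=> bf; elim: r => [|i r IH].
  have -> : (fun x => \sum_(i <- [::] | p i) f i x) = fun=> 0.
    by apply/funext => x; rewrite big_nil.
  exact: bmeas_cst.
have -> : (fun x => \sum_(j <- i :: r | p j) f j x) =
    (fun x => (if p i then f i x else 0) + \sum_(j <- r | p j) f j x).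
  by apply/funext => x; rewrite big_cons; case: ifP; rewrite ?add0r.
apply: bmeasD IH.
by have [pi|_] := boolP (p i); [exact: bf|exact: bmeas_cst].
Qed.

Lemma bmeas_indic (A : set T) : measurable A -> bm (\1_A : T -> R).
Proof.
move=> mA; split; first exact: measurable_indic.
by exists 1 => x; rewrite indicE; case: (_ \in _); rewrite ?normr1 ?normr0.
Qed.

Variable P : probability T R.

Lemma bmeas_integrable f : bm f -> P.-integrable setT (EFin \o f).
Proof.
move=> [mf [M fM]]; apply: measurable_bounded_integrable => //.
  by rewrite (le_lt_trans (probability_le1 _ _))// ltry.
exists M; split; first exact: num_real.
by move=> x Mx y _; apply: (le_trans (fM y)); exact: ltW.
Qed.

Lemma EFin_expect f : bm f -> (\int[P]_x (f x)%:E = (\int[P]_x f x)%R%:E)%E.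
Proof.
by move=> /bmeas_integrable fi; rewrite fineK//; exact: integrable_fin_num.
Qed.

Lemma expect_cst (r : R) : \int[P]_x r = r.
Proof.
rewrite Rintegral_cst// [X in fine X](_ : _ = 1%E) ?mulr1//.
exact: probability_setT.
Qed.

Lemma expectD f g : bm f -> bm g ->
  \int[P]_x (f x + g x) = \int[P]_x f x + \int[P]_x g x.
Proof. by move=> /bmeas_integrable fi /bmeas_integrable gi; rewrite RintegralD. Qed.

Lemma expectB f g : bm f -> bm g ->
  \int[P]_x (f x - g x) = \int[P]_x f x - \int[P]_x g x.
Proof. by move=> /bmeas_integrable fi /bmeas_integrable gi; rewrite RintegralB. Qed.

Lemma expectZ r f : bm f -> \int[P]_x (r * f x) = r * \int[P]_x f x.
Proof. by move=> /bmeas_integrable fi; rewrite RintegralZl. Qed.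

Lemma expect_sum I (r : seq I) (p : pred I) (f : I -> T -> R) :
  (forall i, p i -> bm (f i)) ->
  \int[P]_x (\sum_(i <- r | p i) f i x) = \sum_(i <- r | p i) \int[P]_x f i x.
Proof.
move=> bf; elim: r => [|i r IH].
  by under eq_Rintegral do rewrite big_nil; rewrite expect_cst big_nil.
under eq_Rintegral do rewrite big_cons.
rewrite big_cons; case: ifPn => // pi.
by rewrite expectD ?IH//; [exact: bf|exact: bmeas_sum].
Qed.

Lemma expect_le f g : bm f -> bm g -> (forall x, f x <= g x) ->
  \int[P]_x f x <= \int[P]_x g x.
Proof.
by move=> /bmeas_integrable fi /bmeas_integrable gi fg; rewrite le_Rintegral.
Qed.

Lemma expect_dist_le f g h : bm f -> bm g -> bm h ->
  (forall x, `|f x - g x| <= h x) ->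
  `|\int[P]_x f x - \int[P]_x g x| <= \int[P]_x h x.
Proof.
move=> bf bg bh fgh; rewrite -expectB//.
apply: le_trans (le_normr_Rintegral _ _) _ => //.
  by apply: bmeas_integrable; exact: bmeasB.
apply: expect_le => //; have [mfg [M fgM]] := bmeasB f g bf bg.
by split; [exact: measurableT_comp|exists M => x; rewrite normr_id].
Qed.

End BoundedMeasurable.

Lemma bmeas_slice {d1 d2} {T1 : measurableType d1} {T2 : measurableType d2}
    {R : realType} (f : T1 * T2 -> R) : bounded_measurable f ->
  forall w : T2, bounded_measurable (fun x => f (x, w)).
Proof.
move=> [mf [M fM]] w; split; last by exists M.
by apply: measurableT_comp mf _; exact: measurable_fun_pair.
Qed.

(** Measurability of a partial integral comes from Fubini's theorem, which wants
a measure on the second factor too: any probability, such as a Dirac mass, will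
do. *)
Lemma bmeas_partial_expect {d1 d2} {T1 : measurableType d1}
    {T2 : measurableType d2} {R : realType} (F : probability T1 R) (f : T1 * T2 -> R) :
  bounded_measurable f -> bounded_measurable (fun w => \int[F]_x f (x, w)).
Proof.
move=> bf; have [mf [M fM]] := bf; split.
  apply/measurable_EFinP.
  have fi : (F \x \d_(point : T2))%E.-integrable setT (EFin \o f).
    apply: measurable_bounded_integrable => //.
      rewrite -setXTT [X in (X < _)%E](product_measure1E F (\d_(point : T2))
        measurableT measurableT) [X in (_ * X)%E]diracT mule1.
      by rewrite (le_lt_trans (probability_le1 _ _))// ltry.
    exists M; split; first exact: num_real.
    by move=> x Mx y _; apply: (le_trans (fM y)); exact: ltW.
  have := measurable_fubini_G fi.
  apply: eq_measurable_fun => w _ /=.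
  by rewrite -EFin_expect//; exact: bmeas_slice.
exists M => w; have bw := bmeas_slice f bf w.
have := @expect_dist_le _ _ _ F _ _ _ bw (bmeas_cst 0) (bmeas_cst M).
by rewrite !expect_cst subr0; apply => x; rewrite subr0.
Qed.

Lemma bmeas_normal_cdf {d} {T : measurableType d} {R : realType} (s : R)
  (f : T -> R) : 0 < s ->
  measurable_fun setT f -> bounded_measurable (fun x => normal_cdf s (f x)).
Proof.
move=> s0 mf; split.
  apply: measurableT_comp mf; apply: continuous_measurable_fun.
  exact: continuous_normal_cdf.
by exists 1 => x; rewrite ger0_norm ?normal_cdf_ge0// normal_cdf_le1.
Qed.

(** * One step of the heat flow *)

(** A centred perturbation [b] of variance r s^2 has on Phi, up to second order,
the effect of the dilation z -> z / sqrt (1 + r).  Indeed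
E Phi(z - b) is Phi z + (r s^2 / 2) Phi''(z) up to O(B^3), while
Phi (z / sqrt (1 + r)) is Phi z - (r / 2) z phi z up to O(r^2), and
s^2 Phi''(z) = - z phi z: this is the heat equation in scale-free form.  The
constant does not depend on the probability space, on [z], [b] or [r]. *)
Lemma heat_step {R : realType} (s : R) : 0 < s ->
  exists2 C, 0 < C &
    forall d (T : measurableType d) (P : probability T R) (b : T -> R) (z r B : R),
      measurable_fun setT b -> (forall x, `|b x| <= B) ->
      \int[P]_x b x = 0 -> \int[P]_x (b x ^+ 2) = r * s ^+ 2 ->
      0 <= r <= 3 ->
      `|\int[P]_x normal_cdf s (z - b x) - normal_cdf s ((Num.sqrt (1 + r))^-1 * z)|
        <= C * (B ^+ 3 + r ^+ 2).
Proof.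
move=> s0; have [C1 C10 taylor1] := normal_cdf_taylor s s0.
have [C2 C20 taylor2] := normal_cdf_scale_taylor s s0.
have [K K0 mK] := normal_pdf_moments s s0.
exists (C1 + C2 + 6 * K); first by rewrite !addr_gt0// mulr_gt0.
move=> d T P b z r B mb bB Eb Eb2 /andP[r0 r3].
set p := normal_pdf 0 s z.
have bb : bounded_measurable b by split => //; exists B.
have step1 : `|\int[P]_x normal_cdf s (z - b x) - (normal_cdf s z - r / 2 * (z * p))|
    <= C1 * B ^+ 3.
  have e : \int[P]_x (normal_cdf s z - p * b x - z / s ^+ 2 * p / 2 * (b x * b x))
      = normal_cdf s z - r / 2 * (z * p).
    have b1 := bmeasZ p _ bb.
    have b2 := bmeasZ (z / s ^+ 2 * p / 2) _ (bmeasM _ _ bb bb).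
    have b0 := @bmeas_cst _ T R (normal_cdf s z).
    rewrite expectB//; last exact: bmeasB.
    rewrite expectB// expect_cst !expectZ//; last exact: bmeasM.
    rewrite Eb; under eq_Rintegral do rewrite -expr2.
    by rewrite Eb2; field; rewrite gt_eqF.
  rewrite -e -[leRHS](expect_cst P).
  apply: expect_dist_le.
  - by apply: bmeas_normal_cdf => //; exact: measurable_funB.
  - apply: bmeasB; last exact/bmeasZ/bmeasM.
    by apply: bmeasB; [exact: bmeas_cst|exact: bmeasZ].
  - exact: bmeas_cst.
  - move=> x; have -> : normal_cdf s (z - b x) -
        (normal_cdf s z - p * b x - z / s ^+ 2 * p / 2 * (b x * b x)) =
      normal_cdf s (z - b x) - normal_cdf s z + b x * p
        + b x ^+ 2 / 2 * (z / s ^+ 2 * p).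
      by field; rewrite gt_eqF.
    rewrite (le_trans (taylor1 z (b x)))// ler_wpM2l ?(ltW C10)//.
    by rewrite lerXn2r ?nnegrE// (le_trans _ (bB x)).
have r1 : 0 < 1 + r by rewrite ltr_pwDl.
set c := (Num.sqrt (1 + r))^-1.
have c0 : 0 < c by rewrite invr_gt0 sqrtr_gt0.
have cr : c ^+ 2 * (1 + r) = 1.
  by rewrite exprVn sqr_sqrtr ?(ltW r1)// mulVf// gt_eqF.
have c1 : c <= 1.
  by rewrite -(@ler_pXn2r _ 2) ?nnegrE ?(ltW c0)// expr1n -cr ler_peMr ?sqr_ge0// lerDl.
have c2 : 2^-1 <= c.
  rewrite -(@ler_pXn2r _ 2) ?nnegrE ?invr_ge0 ?(ltW c0)//.
  have : 0 <= c ^+ 2 by rewrite sqr_ge0.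
  nra.
have c20 : c ^+ 2 != 0 by rewrite expf_neq0 ?gt_eqF.
have rE : r = (c ^+ 2)^-1 - 1.
  by apply: (mulfI c20); rewrite mulrBr mulfV// mulr1 -[X in _ = X - _]cr; ring.
(* The defect of linearizing in r rather than in c - 1: from r = c^-2 - 1 one
   gets r / 2 - (1 - c) = (1 - c)^2 (1 + 2 c) / (2 c^2), where the fraction is at
   most 6 on [1/2, 1]. *)
have step2 : `|normal_cdf s (c * z) - (normal_cdf s z - r / 2 * (z * p))|
    <= (C2 + 6 * K) * (c - 1) ^+ 2.
  have := taylor2 z c; rewrite c2 c1 => /(_ isT) h.
  have -> : normal_cdf s (c * z) - (normal_cdf s z - r / 2 * (z * p)) =
     normal_cdf s (c * z) - normal_cdf s z - (c - 1) * (z * p) +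
     (c - 1) ^+ 2 * ((1 + 2 * c) / (2 * c ^+ 2) * (z * p)).
    by rewrite rE; field; rewrite gt_eqF.
  rewrite (le_trans (ler_normD _ _))// (mulrDl C2) lerD//.
  rewrite normrM ger0_norm ?sqr_ge0// mulrC ler_wpM2r ?sqr_ge0//.
  rewrite normrM ler_pM//.
    rewrite ger0_norm; last first.
      by rewrite divr_ge0 ?mulr_ge0 ?addr_ge0 ?mulr_ge0 ?sqr_ge0 ?(ltW c0).
    by rewrite ler_pdivrMr ?mulr_gt0 ?exprn_gt0//; nra.
  have [_ + _ _] := mK z; rewrite -/p normrM => h'.
  by rewrite (ger0_norm (normal_pdf_ge0 _ _ _)).
(* Since r = (1 - c) (1 + c) / c^2, one has 1 - c <= r. *)
have cr2 : (c - 1) ^+ 2 <= r ^+ 2.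
  rewrite -sqrrN opprB lerXn2r ?nnegrE ?subr_ge0//.
  have -> : r = (1 - c) + (1 - c) * ((1 + c) / c ^+ 2 - 1).
    by rewrite rE; field; rewrite gt_eqF.
  rewrite lerDl mulr_ge0 ?subr_ge0// ler_pdivlMr ?exprn_gt0//.
  nra.
rewrite -(subrKA (normal_cdf s z - r / 2 * (z * p))) (le_trans (ler_normD _ _))//.
rewrite (distrC _ (normal_cdf s (c * z))) (mulrDr _ (B ^+ 3)) lerD//.
  rewrite (le_trans step1)// ler_wpM2r//; last by lra.
  by rewrite exprn_ge0// (le_trans _ (bB point)).
by rewrite (le_trans step2)// ler_pM ?sqr_ge0//; lra.
Qed.

(** * Independence as integration of one coordinate *)

Section Freezing.
Context {d d'} {T : measurableType d} {Omega : measurableType d'} {R : realType}.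
Context {P : probability T R} {F : probability Omega R}.
Variables (X : nat -> {RV P >-> Omega}).
Hypothesis X_iid : iid X F.
Variable i : nat.

(** The events that constrain finitely many of the variables other than [X i]:
a pi-system generating the sigma-algebra of these variables. *)
Definition cylinders : set (set T) :=
  [set C | exists J : {fset nat}, exists A : nat -> set Omega,
    [/\ i \notin J, forall k, measurable (A k) &
        C = \bigcap_(k in [set` J]) X k @^-1` A k]].

(** The sample space [T] with the sigma-algebra of the variables [X k], k <> i.
Measurability with respect to it says that a quantity does not involve [X i],
and is proved by the usual closure rules since [others] is itself a measurable
type. *)
Definition others := g_sigma_algebraType cylinders.

Lemma cylinders_setI : setI_closed cylinders.
Proof.
move=> _ _ [J1 [A1 [iJ1 mA1 ->]]] [J2 [A2 [iJ2 mA2 ->]]].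
exists (J1 `|` J2)%fset.
exists (fun k => (if k \in J1 then A1 k else setT) `&`
                 (if k \in J2 then A2 k else setT)).
split.
- by rewrite in_fsetU negb_or iJ1.
- by move=> k; apply: measurableI; case: ifP.
- apply/seteqP; split=> [w [h1 h2] k _|w h].
    by split; case: ifPn => // kJ; [exact: h1|exact: h2].
  split=> k /= kJ; have := h k.
    by rewrite /= in_fsetU kJ => /(_ isT)[].
  by rewrite /= in_fsetU kJ orbT => /(_ isT)[].
Qed.

Lemma cylinders_measurable : cylinders `<=` measurable.
Proof.
move=> _ [J [A [_ mA ->]]]; apply: fin_bigcap_measurable => [|k _].
  exact: finite_fset.
exact: measurable_funPTI.
Qed.

Lemma others_measurable (S : set T) : <<s cylinders >> S -> measurable S.
Proof.
apply: smallest_sub; first exact: sigma_algebra_measurable.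
exact: cylinders_measurable.
Qed.

Lemma measurable_others k : k != i ->
  measurable_fun [set: others] (X k : others -> Omega).
Proof.
move=> ki _ B mB; rewrite setTI; apply: sub_sigma_algebra.
exists [fset k]%fset; exists (fun=> B); split => //.
  by rewrite in_fset1 eq_sym.
by rewrite set_fset1 bigcap_set1.
Qed.

(** Both sides are finite measures in [S]; they agree on the cylinders by mutual
independence, hence on the generated sigma-algebra. *)
Lemma indep_cylinders (B : set Omega) (S : set T) : measurable B ->
  <<s cylinders >> S -> (P (X i @^-1` B `&` S) = F B * P S)%E.
Proof.
move=> mB.
have [indX lawX] := X_iid.
have mXB : measurable (X i @^-1` B) by exact: measurable_funPTI.
have fFB : 0 <= fine (F B) by exact: fine_ge0.
pose m1 := mrestr P mXB.
pose m2 := mscale (NngNum fFB) P.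
suff : forall E, <<s cylinders >> E -> m1 E = m2 E.
  move=> h /h; rewrite /m1 /m2 /mrestr /mscale/= setIC => ->.
  by rewrite fineK// fin_num_measure.
apply: (g_sigma_algebra_measure_unique cylinders _ (fun=> setT)).
- exact: cylinders_measurable.
- move=> _; exists fset0; exists (fun=> setT); split => //.
  by rewrite set_fset0 bigcap_set0.
- by rewrite bigcup_const//; exists 0%N.
- exact: cylinders_setI.
- move=> _ [J [A [iJ mA ->]]]; set C := \bigcap_(k in _) _.
  change (P (C `&` X i @^-1` B) = (fine (F B))%:E * P C)%E.
  rewrite fineK ?fin_num_measure// {}/C.
  (* Adding the constraint X i in B turns a cylinder into a constraint on the
     finite set i |` J, to which mutual independence applies. *)
  pose A' k := if k == i then B else A k.
  have mA' k : measurable (A' k) by rewrite /A'; case: ifP.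
  have eJ : \bigcap_(k in [set` J]) X k @^-1` A k =
            \bigcap_(k in [set` J]) X k @^-1` A' k.
    apply: eq_bigcapr => k /= kJ; rewrite /A'.
    by case: eqP => // ki; rewrite -ki kJ in iJ.
  have e : (\bigcap_(k in [set` J]) X k @^-1` A k) `&` X i @^-1` B =
      \bigcap_(k in [set` (i |` J)%fset]) X k @^-1` A' k.
    by rewrite set_fsetU1 bigcap_setU1 setIC eJ /A' eqxx.
  rewrite e eJ !indX// big_fsetU1//= /A' eqxx; congr (_ * _)%E.
  exact: (lawX i B mB).
- move=> _; change (P (setT `&` X i @^-1` B) < +oo)%E.
  by rewrite setTI (le_lt_trans (probability_le1 _ _))// ltry.
Qed.

(* The pair (X i, identity), valued in Omega * others, has the product of F and P
   as its law. *)
Let forget (w : T) : others := w.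
Let joint (w : T) : Omega * others := (X i w, forget w).

Let mforget : measurable_fun setT forget.
Proof. by move=> _ S mS; rewrite setTI; exact: others_measurable. Qed.

#[local] HB.instance Definition _ :=
  @isMeasurableFun.Build _ _ T others forget mforget.

Let mjoint : measurable_fun setT joint.
Proof. exact: measurable_fun_pair. Qed.

#[local] HB.instance Definition _ :=
  @isMeasurableFun.Build _ _ T (Omega * others)%type joint mjoint.

Let Q := distribution P (forget : {RV P >-> others}).
Let L := distribution P (joint : {RV P >-> (Omega * others)%type}).

Let LE : forall S, measurable S -> (F \x Q)%E S = L S.
Proof. by apply: product_measure_unique => A B mA mB; exact: indep_cylinders. Qed.

Let integrable_prod (f : Omega * others -> R) : bounded_measurable f ->
  (F \x Q)%E.-integrable setT (EFin \o f).
Proof.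
move=> [mf [M fM]]; apply: measurable_bounded_integrable => //.
  rewrite [X in (X < _)%E](LE setT measurableT).
  by rewrite (le_lt_trans (probability_le1 _ _))// ltry.
exists M; split; first exact: num_real.
by move=> x Mx y _; apply: (le_trans (fM y)); exact: ltW.
Qed.

(** Fubini's theorem for the product law of [X i] and of the sample point seen
through the other variables. *)
Lemma freezing (f : Omega * others -> R) : bounded_measurable f ->
  \int[P]_w f (X i w, w) = \int[P]_w \int[F]_x f (x, w).
Proof.
move=> bf; have [mf [M fM]] := bf.
have bj : bounded_measurable (fun w => f (joint w)).
  by split; [exact: measurableT_comp mjoint|exists M].
have bg := bmeas_partial_expect F f bf.
have bg' : bounded_measurable (fun w => \int[F]_x f (x, forget w)).
  case: bg => mg [M' gM]; split; last by exists M'.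
  exact: (measurableT_comp mg mforget).
congr fine.
transitivity (\int[L]_z (f z)%:E)%E.
  rewrite integral_distribution//; first exact/measurable_EFinP.
  exact: bmeas_integrable.
transitivity (\int[F \x Q]_z (f z)%:E)%E.
  by apply: eq_measure_integral => S mS _; rewrite -[LHS](LE S mS).
rewrite -(integral21_prod_meas1 (integrable_prod f bf)).
transitivity (\int[Q]_w (\int[F]_x f (x, w))%R%:E)%E.
  by apply: eq_integral => w _; rewrite -EFin_expect//; exact: bmeas_slice.
rewrite integral_distribution//; last exact: bmeas_integrable.
by apply/measurable_EFinP; case: bg.
Qed.
End Freezing.

(** * Lindeberg's telescoping sum *)

Lemma expect_law {d d'} {T : measurableType d} {Omega : measurableType d'}
    {R : realType} {P : probability T R} {F : probability Omega R}
    (X : nat -> {RV P >-> Omega}) (i : nat) (f : Omega -> R) :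
  iid X F -> bounded_measurable f -> \int[P]_w f (X i w) = \int[F]_x f x.
Proof.
move=> [_ lawX] bf; have [mf [M fM]] := bf; congr fine.
transitivity (\int[distribution P (X i)]_x (f x)%:E)%E.
  rewrite integral_distribution//; first exact/measurable_EFinP.
  by apply: bmeas_integrable; split; [exact: measurableT_comp|exists M].
by apply: eq_measure_integral => S mS _; exact: lawX.
Qed.

Lemma invr_sqrt_cvg0 {R : realType} :
  (Num.sqrt n%:R)^-1 @[n --> \oo] --> (0 : R).
Proof.
have h : Num.sqrt (n%:R^-1) @[n --> \oo] --> (Num.sqrt 0 : R).
  apply: continuous_cvg; first exact: sqrt_continuous.
  apply/(@gtr0_cvgV0 R nat \oo _ (fun n => n%:R)); last exact: cvgr_idn.
  by near=> n; rewrite ltr0n; near: n; exact: nbhs_infty_gt.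
rewrite sqrtr0 in h; apply: cvg_trans h; apply: near_eq_cvg.
by near=> n; rewrite sqrtrV.
Unshelve. all: by end_near. Qed.

Section Lindeberg.
Context {d d'} {T : measurableType d} {Omega : measurableType d'} {R : realType}.
Context {P : probability T R} {F : probability Omega R}.
Variables (X : nat -> {RV P >-> Omega}).
Hypothesis X_iid : iid X F.
Variables (g : Omega -> R) (s : R).
Hypotheses (bg : bounded_measurable g) (s0 : 0 < s).
Hypotheses (Eg : \int[F]_x g x = 0) (Eg2 : \int[F]_x (g x ^+ 2) = s ^+ 2).

Let S n (w : T) := \sum_(k < n) g (X k w).

Lemma measurable_partial_sum k n : (n <= k)%N ->
  measurable_fun setT (S n : others X k -> R).
Proof.
move=> nk; apply: measurable_sum => j.
apply: measurableT_comp; first by case: bg.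
by apply: measurable_others; rewrite ltn_eqF// (leq_trans _ nk).
Qed.

Lemma measurable_partial_sumT n : measurable_fun setT (S n : T -> R).
Proof.
apply: measurable_sum => j; apply: measurableT_comp; first by case: bg.
exact: measurable_funPT.
Qed.

(** The expectation [V k] of Phi((t - S_k / sqrt n) / sqrt (a k)), with
a k = del^2 + (n - k) / n, goes from Phi(t / sqrt (1 + del^2)) at k = 0 to
E Phi((t - S_n / sqrt n) / del) at k = n.  Passing from k to k + 1 adds the
summand g (X k) / sqrt n, independent of S_k, and removes 1 / n from a k; by
[heat_step], applied after freezing S_k, these two changes compensate up to
O(n^(-3/2)).  The positive del keeps the scale a k away from 0. *)
Lemma lindeberg (t del : R) : 0 < del -> exists K, forall n : nat,
  1 <= n%:R * del ^+ 2 -> (0 < n)%N ->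
  `|\int[P]_w normal_cdf s ((t - S n w / Num.sqrt n%:R) / del)
     - normal_cdf s (t / Num.sqrt (1 + del ^+ 2))| <= K / Num.sqrt n%:R.
Proof.
move=> del0; have [C C0 heat] := heat_step s s0.
have [mg [M gM]] := bg.
have M0 : 0 <= M by rewrite (le_trans _ (gM point)).
exists (C * ((M / del) ^+ 3 + del ^- 4)) => n nd n0.
have nR : 0 < n%:R :> R by rewrite ltr0n.
set q := Num.sqrt n%:R.
have q0 : 0 < q by rewrite sqrtr_gt0.
have qq : q ^+ 2 = n%:R by rewrite sqr_sqrtr// ltW.
pose a k : R := del ^+ 2 + (n%:R - k%:R) / n%:R.
pose V k := \int[P]_w normal_cdf s ((t - S k w / q) / Num.sqrt (a k)).
pose err := C * ((M / (q * del)) ^+ 3 + (n%:R * del ^+ 2)^-1 ^+ 2).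
have d20 : 0 < del ^+ 2 by rewrite exprn_gt0.
have step k : (k < n)%N -> `|V k.+1 - V k| <= err.
  move=> kn.
  have ak : del ^+ 2 <= a k.+1 by rewrite lerDl divr_ge0 ?subr_ge0 ?ler_nat// ltW.
  have ak0 : 0 < a k.+1 by rewrite (lt_le_trans d20).
  have sak0 : 0 < Num.sqrt (a k.+1) by rewrite sqrtr_gt0.
  have sak : del <= Num.sqrt (a k.+1).
    by rewrite -(gtr0_norm del0) -sqrtr_sqr ler_wsqrtr.
  (* In units of sqrt (a k.+1) the summand has variance r s^2, and
     a k = a k.+1 (1 + r). *)
  pose r := (n%:R * a k.+1)^-1.
  have r0 : 0 <= r by rewrite invr_ge0 mulr_ge0// ltW.
  have rle : r <= (n%:R * del ^+ 2)^-1.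
    by rewrite lef_pV2 ?posrE ?mulr_gt0// ler_wpM2l// ltW.
  have r3 : r <= 3.
    apply: (le_trans rle); apply: (@le_trans _ _ 1); last by rewrite ler1n.
    by rewrite invf_le1 ?mulr_gt0.
  have aE : a k = a k.+1 * (1 + r).
    rewrite /r invfM mulrDr mulr1 mulrCA mulfV ?gt_eqF// mulr1 /a -natr1.
    by field; rewrite gt_eqF.
  pose f (xw : Omega * others X k) :=
    normal_cdf s ((t - (S k xw.2 + g xw.1) / q) / Num.sqrt (a k.+1)).
  have bf : bounded_measurable f.
    apply: bmeas_normal_cdf => //; apply: measurable_funM => //.
    apply: measurable_funB => //; apply: measurable_funM => //.
    apply: measurable_funD; last exact: measurableT_comp.
    by apply: measurableT_comp; first exact: (measurable_partial_sum k k).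
  have -> : V k.+1 = \int[P]_w \int[F]_x f (x, w).
    transitivity (\int[P]_w f (X k w, w)); last exact: freezing.
    by apply: eq_Rintegral => w _; rewrite /f /S big_ord_recr.
  rewrite -(expect_cst P err); apply: expect_dist_le.
  - have [mG [M' GM]] := bmeas_partial_expect F f bf.
    split; last by exists M'.
    move=> _ B mB; apply: (others_measurable X k).
    exact: mG.
  - apply: bmeas_normal_cdf => //; apply: measurable_funM => //.
    apply: measurable_funB => //; apply: measurable_funM => //.
    exact: measurable_partial_sumT.
  - exact: bmeas_cst.
  move=> w.
  pose z := (t - S k w / q) / Num.sqrt (a k.+1).
  pose b x := g x / (q * Num.sqrt (a k.+1)).
  have B0 : 0 <= (q * Num.sqrt (a k.+1))^-1 by rewrite invr_ge0 mulr_ge0// ltW.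
  have := heat _ _ F b z r (M / (q * del)).
  have -> : (Num.sqrt (1 + r))^-1 * z = (t - S k w / q) / Num.sqrt (a k).
    by rewrite aE sqrtrM ?(ltW ak0)// invfM /z mulrC mulrA.
  have -> : \int[F]_x f (x, w) = \int[F]_x normal_cdf s (z - b x).
    apply: eq_Rintegral => x _; rewrite /f /z /b/=; congr (normal_cdf s _).
    by field; rewrite !gt_eqF.
  move=> h; apply: (le_trans (h _ _ _ _ _)).
  - exact: measurable_funM.
  - move=> x; rewrite normrM (ger0_norm B0) ler_pM// lef_pV2 ?posrE ?mulr_gt0//.
    by rewrite ler_wpM2l// ltW.
  - by under eq_Rintegral do rewrite /b mulrC; rewrite expectZ// Eg mulr0.
  - have -> : r = (q * Num.sqrt (a k.+1))^-1 ^+ 2.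
      by rewrite /r exprVn exprMn qq sqr_sqrtr ?(ltW ak0).
    under eq_Rintegral do rewrite /b exprMn mulrC.
    by rewrite expectZ ?Eg2//; exact: bmeas_sqr.
  - by rewrite r0.
  - rewrite ler_wpM2l ?(ltW C0)// lerD2l lerXn2r// nnegrE.
    by rewrite invr_ge0 mulr_ge0// ltW.
have tele k : (k <= n)%N -> `|V k - V 0%N| <= k%:R * err.
  elim: k => [|k IH] kn; first by rewrite subrr normr0 mul0r.
  rewrite -(subrKA (V k)) (le_trans (ler_normD _ _))//.
  rewrite -natr1 mulrDl mul1r (addrC (k%:R * err)); apply: lerD.
    exact: step.
  by apply: IH; exact: ltnW.
have := tele n (leqnn _).
have -> : V 0%N = normal_cdf s (t / Num.sqrt (1 + del ^+ 2)).
  rewrite /V /a /S subr0 mulfV ?gt_eqF// addrC.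
  under eq_Rintegral do rewrite big_ord0 mul0r subr0.
  by rewrite expect_cst.
have -> : V n = \int[P]_w normal_cdf s ((t - S n w / q) / del).
  by rewrite /V /a subrr mul0r addr0 sqrtr_sqr gtr0_norm.
move=> /le_trans; apply.
have e1 : n%:R * (M / (q * del)) ^+ 3 = (M / del) ^+ 3 / q.
  by rewrite -qq; field; rewrite !gt_eqF.
have e2 : n%:R * (n%:R * del ^+ 2)^-1 ^+ 2 = del ^- 4 / n%:R.
  by field; rewrite !gt_eqF.
rewrite /err mulrCA -mulrA ler_wpM2l ?(ltW C0)// (mulrDr n%:R) e1 e2.
rewrite (mulrDl _ _ q^-1) lerD2l ler_wpM2l ?invr_ge0 ?exprn_ge0 ?(ltW del0)//.
rewrite lef_pV2 ?posrE// -qq expr2 ler_peMl ?(ltW q0)//.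
by rewrite -[leLHS]sqrtr1 ler_wsqrtr// ler1n.
Qed.

End Lindeberg.

(** * A central limit theorem with a negligible remainder *)

Lemma sandwich_dist {R : realType} (x p I J u l eta : R) :
  p <= I + eta -> J - eta <= p -> `|u - I| <= eta -> `|l - J| <= eta ->
  `|x - u| < eta -> `|x - l| < eta -> `|x - p| <= eta * 3.
Proof.
rewrite !ler_norml !ltr_norml => pI Jp /andP[? ?] /andP[? ?] /andP[? ?] /andP[? ?].
by apply/andP; split; lra.
Qed.

(** The indicator of y <= t lies between Phi((t - eps - y) / del) - eta and
Phi((t + eps - y) / del) + eta as soon as eps / del is so large that
Phi (eps / del) >= 1 - eta and Phi (- eps / del) <= eta.  The limits
Phi((t +- eps) / sqrt (1 + del^2)) are close to Phi t when eps and del are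
small. *)
Lemma cvg_in_law_normal {d} {T : measurableType d} {R : realType}
    (P : probability T R) (Y : nat -> T -> R) (s : R) : 0 < s ->
  (forall n, measurable_fun setT (Y n)) ->
  (forall t del : R, 0 < del ->
    \int[P]_w normal_cdf s ((t - Y n w) / del) @[n --> \oo]
      --> normal_cdf s (t / Num.sqrt (1 + del ^+ 2))) ->
  cvg_in_law P Y (normal_prob 0 s).
Proof.
move=> s0 mY smooth; split => // t _.
have mYt n : measurable [set w | Y n w <= t].
  rewrite -[X in measurable X]setTI.
  have -> : [set w | Y n w <= t] = Y n @^-1` `]-oo, t].
    by apply/seteqP; split => w /=; rewrite in_itv.
  exact: mY.
pose p n := \int[P]_w (\1_[set w | Y n w <= t] w : R).
have pE n : P [set w | Y n w <= t] = (p n)%:E.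
  by rewrite -EFin_expect ?integral_indic ?setIT//; exact: bmeas_indic.
under eq_cvg do rewrite pE.
suff : (p n)%:E @[n --> \oo] --> (normal_cdf s t)%:E.
  by rewrite fineK ?fin_num_measure.
apply: cvg_EFin; first by near=> n.
apply/cvgrPdist_le => e e0.
pose eta := e / 3.
have eta0 : 0 < eta by rewrite divr_gt0.
have [eps eps0 ncont] : exists2 eps, 0 < eps & forall u : R, `|t - u| < 2 * eps ->
    `|normal_cdf s t - normal_cdf s u| < eta.
  have /cvgrPdist_lt/(_ eta eta0) := @continuous_normal_cdf _ s s0 t.
  move=> /nbhs_ballP[r /= r0 h]; exists (r / 2); first by rewrite divr_gt0.
  by move=> u tu; apply: h; rewrite /ball/= mulrC divfK// in tu *.
have [A A0 [Ay ANy]] : exists2 A : R, 0 < A &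
    1 - eta <= normal_cdf s A /\ normal_cdf s (- A) <= eta.
  have h : normal_cdf s (- A) @[A --> +oo] --> (0 : R).
    by move: (@normal_cdf_cvgNy _ s); rewrite cvgNy_compNP.
  near (+oo : set_system R) => A; exists A; first by near: A; exact: nbhs_pinfty_gt.
  split.
    have : `|1 - normal_cdf s A| <= eta.
      near: A; exact: (cvgrPdist_le _ _).1 (@normal_cdf_cvgy _ s) _ eta0.
    by rewrite ler_norml => /andP[_]; lra.
  have : `|0 - normal_cdf s (- A)| <= eta.
    near: A; exact: (cvgrPdist_le _ _).1 h _ eta0.
  by rewrite sub0r normrN => /(le_trans (ler_norm _)).
(* The second bound makes eps / del >= A; the last one keeps the dilation by
   sqrt (1 + del^2) from moving t +- eps by more than eps. *)
pose del := Num.min 1 (Num.min (eps / A) (eps / (`|t| + eps + 1))).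
have te0 : 0 < `|t| + eps + 1 by rewrite ltr_wpDl// addr_ge0// ltW.
have del0 : 0 < del by rewrite !lt_min ltr01 !divr_gt0.
have [del1 delA delt] : [/\ del <= 1, A * del <= eps & (`|t| + eps + 1) * del <= eps].
  split; first by rewrite ge_min lexx.
    by rewrite mulrC -ler_pdivlMr// !ge_min lexx !orbT.
  by rewrite mulrC -ler_pdivlMr// !ge_min lexx !orbT.
have Adel : A <= eps / del by rewrite ler_pdivlMr.
have close u : `|u - t| <= eps ->
    `|normal_cdf s t - normal_cdf s (u / Num.sqrt (1 + del ^+ 2))| < eta.
  move=> ut; apply: ncont.
  have d2 : 0 <= del ^+ 2 by rewrite sqr_ge0.
  set q := Num.sqrt _.
  have q1 : 1 <= q by rewrite -[leLHS]sqrtr1 ler_wsqrtr// lerDl.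
  have qle : q <= 1 + del ^+ 2.
    rewrite -[leRHS]ger0_norm ?addr_ge0// -sqrtr_sqr ler_wsqrtr// expr2.
    by rewrite ler_peMl ?addr_ge0// lerDl.
  have q0 : 0 < q by rewrite (lt_le_trans _ q1).
  rewrite -(subrKA u) (le_lt_trans (ler_normD _ _))// (mulrDl 1 1 eps) mul1r.
  apply: ler_ltD; first by rewrite distrC.
  have -> : u - u / q = u * (1 - q^-1) by rewrite mulrBr mulr1.
  have iq : 0 <= 1 - q^-1 by rewrite subr_ge0 invf_le1.
  have iq' : 1 - q^-1 <= del.
    rewrite -(ler_pM2l q0) mulrBr mulr1 mulfV ?gt_eqF//.
    rewrite lerBlDr (le_trans qle)// addrC lerD2r expr2.
    by rewrite ler_wpM2r ?(ltW del0)// (le_trans del1).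
  rewrite normrM (ger0_norm iq) (le_lt_trans (ler_wpM2l _ iq'))//.
  rewrite (lt_le_trans _ delt)// ltr_pM2r//.
  have : `|u| <= `|t| + eps.
    by rewrite -(subrK t u) (le_trans (ler_normD _ _))// addrC lerD2l.
  by lra.
have up : \forall n \near \oo,
    `|normal_cdf s ((t + eps) / Num.sqrt (1 + del ^+ 2))
       - \int[P]_w normal_cdf s ((t + eps - Y n w) / del)| <= eta.
  exact: (cvgrPdist_le _ _).1 (smooth (t + eps) del del0) _ eta0.
have lo : \forall n \near \oo,
    `|normal_cdf s ((t - eps) / Num.sqrt (1 + del ^+ 2))
       - \int[P]_w normal_cdf s ((t - eps - Y n w) / del)| <= eta.
  exact: (cvgrPdist_le _ _).1 (smooth (t - eps) del del0) _ eta0.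
have bY u n : bounded_measurable (fun w => normal_cdf s ((u - Y n w) / del)).
  apply: bmeas_normal_cdf => //; apply: measurable_funM => //.
  exact: measurable_funB.
apply: filterS2 up lo => n.
have pup : p n <= \int[P]_w normal_cdf s ((t + eps - Y n w) / del) + eta.
  rewrite -[X in _ + X](expect_cst P) -expectD//; last exact: bmeas_cst.
  apply: expect_le => [||w]; [exact: bmeas_indic| |].
    by apply: bmeasD => //; exact: bmeas_cst.
  rewrite indicE; have [|] := boolP (w \in _).
    rewrite inE/= => Yt; rewrite -lerBlDr (le_trans Ay)// normal_cdf_homo//.
    by rewrite (le_trans Adel)// ler_pM2r ?invr_gt0//; lra.
  by move=> _; rewrite addr_ge0 ?normal_cdf_ge0// ltW.
have plo : \int[P]_w normal_cdf s ((t - eps - Y n w) / del) - eta <= p n.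
  rewrite -[X in _ - X](expect_cst P) -expectB//; last exact: bmeas_cst.
  apply: expect_le => [||w]; [|exact: bmeas_indic|].
    by apply: bmeasB => //; exact: bmeas_cst.
  rewrite indicE; have [_|] := boolP (w \in _).
    by rewrite (le_trans _ (normal_cdf_le1 s ((t - eps - Y n w) / del)))// gerBl ltW.
  rewrite notin_setE/= => /negP; rewrite -ltNge => Yt.
  rewrite subr_le0 (le_trans _ ANy)// normal_cdf_homo//.
  rewrite lerNr (le_trans Adel)// -mulNr ler_pM2r ?invr_gt0//; lra.
have -> : e = eta * 3 by rewrite /eta divfK.
move=> hu hl; apply: sandwich_dist pup plo hu hl _ _; apply: close.
  by rewrite addrAC subrr add0r gtr0_norm.
by rewrite addrAC subrr add0r normrN gtr0_norm.
Unshelve. all: by end_near. Qed.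

(** The passage from the normalized sum [W] to [Y] costs, at the level of the
smoothed indicators, at most a constant times E |Y - W|, and
2 |x| <= 1 / q + q x^2 with q = sqrt n turns the second moment K / n into
(1 + K) / (2 sqrt n). *)
Theorem clt_remainder {d d'} {T : measurableType d} {Omega : measurableType d'}
    {R : realType} {P : probability T R} {F : probability Omega R}
    (X : nat -> {RV P >-> Omega}) (g : Omega -> R) (s : R)
    (Y : nat -> T -> R) (K : R) :
  iid X F -> bounded_measurable g -> 0 < s ->
  \int[F]_x g x = 0 -> \int[F]_x (g x ^+ 2) = s ^+ 2 ->
  (forall n, bounded_measurable (Y n)) ->
  (\forall n \near \oo,
     \int[P]_w ((Y n w - (\sum_(k < n) g (X k w)) / Num.sqrt n%:R) ^+ 2)
       <= K / n%:R) ->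
  cvg_in_law P Y (normal_prob 0 s).
Proof.
move=> X_iid bg s0 Eg Eg2 bY small.
apply: cvg_in_law_normal => //; first by move=> n; case: (bY n).
move=> t del del0.
have [C lind] := lindeberg X X_iid g s bg s0 Eg Eg2 t del del0.
have [L L0 lip] := normal_cdf_lipschitz s s0.
pose M := L / del * ((1 + K) / 2) + C.
have M0 : M / Num.sqrt n%:R @[n --> \oo] --> (0 : R).
  by rewrite -[X in _ --> X](mulr0 M); apply: cvgMr; exact: invr_sqrt_cvg0.
apply/cvgrPdist_le => e e0.
have [mg _] := bg.
have mS n : measurable_fun setT (fun w => (\sum_(k < n) g (X k w)) / Num.sqrt n%:R : R).
  by apply: measurable_funM => //; exact: (measurable_partial_sumT X g bg n).
near=> n.
have n0 : (0 < n)%N by near: n; exact: nbhs_infty_gt.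
have nd : 1 <= n%:R * del ^+ 2.
  rewrite -ler_pdivrMr ?exprn_gt0//; near: n; exact: nbhs_infty_ger.
have En : \int[P]_w ((Y n w - (\sum_(k < n) g (X k w)) / Num.sqrt n%:R) ^+ 2)
     <= K / n%:R.
  near: n; exact: small.
set q := Num.sqrt n%:R in En.
have q0 : 0 < q by rewrite sqrtr_gt0 ltr0n.
have qq : q ^+ 2 = n%:R by rewrite sqr_sqrtr.
pose W w := (\sum_(k < n) g (X k w)) / q.
have bW : bounded_measurable W.
  split; first exact: mS.
  have [_ [G gG]] := bg; exists (\sum_(k < n) G * q^-1) => w.
  rewrite /W mulr_suml; apply: (le_trans (ler_norm_sum _ _ _)).
  apply: ler_sum => k _.
  have iq0 : 0 < q^-1 by rewrite invr_gt0.
  by rewrite normrM (gtr0_norm iq0) ler_pM2r.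
have bYW : bounded_measurable (fun w => (Y n w - W w) ^+ 2).
  by apply: bmeas_sqr; exact: bmeasB.
have bphi (Z : T -> R) : measurable_fun setT Z ->
    bounded_measurable (fun w => normal_cdf s ((t - Z w) / del)).
  move=> mZ; apply: bmeas_normal_cdf => //; apply: measurable_funM => //.
  exact: measurable_funB.
have bound : `|\int[P]_w normal_cdf s ((t - Y n w) / del)
       - \int[P]_w normal_cdf s ((t - W w) / del)|
    <= L / del * ((1 + K) / 2) / q.
  have bq : bounded_measurable (fun w => q^-1 + q * (Y n w - W w) ^+ 2).
    by apply: bmeasD; [exact: bmeas_cst|exact: bmeasZ].
  apply: (@le_trans _ _ (\int[P]_w (L / del / 2 * (q^-1 + q * (Y n w - W w) ^+ 2)))).
    apply: expect_dist_le.
    - by apply: bphi; case: (bY n).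
    - by apply: bphi; case: bW.
    - exact: (bmeasZ _ _ bq).
    - move=> w; rewrite (le_trans (lip _ _))//.
      have id0 : 0 < del^-1 by rewrite invr_gt0.
      set x := Y n w - W w.
      have -> : (t - Y n w) / del - (t - W w) / del = - (x / del) by rewrite /x; ring.
      rewrite normrN normrM (gtr0_norm id0).
      have -> : L / del / 2 * (q^-1 + q * x ^+ 2) =
          L * (`|x| / del) + L / del / (2 * q) * (1 - q * `|x|) ^+ 2.
        by rewrite -(real_normK (num_real x)); field; rewrite !gt_eqF.
      by rewrite lerDl mulr_ge0 ?sqr_ge0// divr_ge0 ?divr_ge0 ?mulr_ge0// ltW.
  rewrite expectZ// expectD; [|exact: bmeas_cst|exact: bmeasZ].
  rewrite expect_cst expectZ//.
  have -> : L / del * ((1 + K) / 2) / q = L / del / 2 * (q^-1 + q * (K / n%:R)).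
    by rewrite -qq; field; rewrite !gt_eqF.
  by rewrite ler_wpM2l ?divr_ge0 ?(ltW L0) ?(ltW del0)// lerD2l ler_wpM2l// ltW.
have Mn : `|0 - M / q| <= e.
  by rewrite /q; near: n; exact: (cvgrPdist_le _ _).1 M0 _ e0.
rewrite distrC (le_trans _ Mn)// sub0r normrN (le_trans _ (ler_norm _))//.
rewrite -(subrKA (\int[P]_w normal_cdf s ((t - W w) / del))) (le_trans (ler_normD _ _))//.
by rewrite /M mulrDl lerD//; exact: lind.
Unshelve. all: by end_near. Qed.

(** * Hoeffding's decomposition *)

Lemma sum_offdiag {V : zmodType} n (f : 'I_n -> V) :
  \sum_(p : 'I_n * 'I_n | p.1 != p.2) f p.1 = (\sum_i f i) *+ n.-1.
Proof.
rewrite -(pair_big_dep xpredT (fun i j => i != j) (fun i _ => f i))/=.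
rewrite -sumrMnl; apply: eq_bigr => i _; rewrite sumr_const; congr (_ *+ _).
rewrite -[in RHS](card_ord n) -(cardC1 i).
by apply: eq_card => j; rewrite !inE eq_sym.
Qed.

Lemma sum_offdiag_swap {V : zmodType} n (f : 'I_n -> 'I_n -> V) :
  \sum_(p : 'I_n * 'I_n | p.1 != p.2) f p.2 p.1 =
  \sum_(p : 'I_n * 'I_n | p.1 != p.2) f p.1 p.2.
Proof.
rewrite [RHS](reindex_inj (h := fun p : 'I_n * 'I_n => (p.2, p.1))) /=.
  by apply: eq_bigl => p; rewrite eq_sym.
by move=> [a b] [a' b'] [-> ->].
Qed.

Section Hoeffding.
Context {d d'} {T : measurableType d} {Omega : measurableType d'} {R : realType}.
Context {P : probability T R} {F : probability Omega R}.
Variables (X : nat -> {RV P >-> Omega}).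
Hypothesis X_iid : iid X F.
Variable H : Omega * Omega -> R.
Hypothesis bH : bounded_measurable H.
Hypothesis symH : forall x y, H (x, y) = H (y, x).

Definition kernel_section (y : Omega) : R := \int[F]_x H (x, y).
Definition kernel_mean : R := \int[F]_y kernel_section y.
Local Notation g0 := kernel_section.
Local Notation th := kernel_mean.

Lemma bmeas_kernel_section : bounded_measurable g0.
Proof. exact: bmeas_partial_expect. Qed.

Lemma bmeas_others2 (f : Omega * Omega -> R) i j k : bounded_measurable f ->
  j != i -> k != i ->
  bounded_measurable (fun w : others X i => f (X j w, X k w)).
Proof.
move=> [mf [M fM]] ji ki; split; last by exists M.
by apply: measurableT_comp mf _; apply: measurable_fun_pair; exact: measurable_others.
Qed.

Lemma bmeas_pair (f : Omega * Omega -> R) j k : bounded_measurable f ->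
  bounded_measurable (fun w : T => f (X j w, X k w)).
Proof.
move=> [mf [M fM]]; split; last by exists M.
by apply: measurableT_comp mf _; exact: measurable_fun_pair.
Qed.

Lemma bmeas_frozen_left (f : Omega * Omega -> R) i j :
    bounded_measurable f -> j != i ->
  bounded_measurable (fun xw : Omega * others X i => f (xw.1, X j xw.2)).
Proof.
move=> [mf [M fM]] ji; split; last by exists M.
apply: measurableT_comp mf _; apply: measurable_fun_pair => //.
by apply: measurableT_comp => //; exact: measurable_others.
Qed.

Lemma bmeas_frozen_right i (f : others X i -> R) : bounded_measurable f ->
  bounded_measurable (fun xw : Omega * others X i => f xw.2).
Proof.
move=> [mf [M fM]]; split; last by exists M.
exact: measurableT_comp mf _.
Qed.

Lemma expect_kernel i j : i != j -> \int[P]_w H (X i w, X j w) = th.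
Proof.
move=> ij; have ji : j != i by rewrite eq_sym.
rewrite (freezing X X_iid i (fun xw => H (xw.1, X j xw.2))); last first.
  exact: bmeas_frozen_left.
exact: (expect_law X j g0 X_iid bmeas_kernel_section).
Qed.

(** Given X i, the variables X j and X k are independent, so the conditional
expectation of the product is the square of [kernel_section]. *)
Lemma expect_kernel2 i j k : uniq [:: i; j; k] ->
  \int[P]_w (H (X i w, X j w) * H (X i w, X k w)) = \int[F]_y (g0 y ^+ 2).
Proof.
rewrite /= !inE negb_or => /andP[/andP[ij ik] /andP[jk _]].
have kj : k != j by rewrite eq_sym.
transitivity (\int[P]_w (H (X j w, X i w) * H (X i w, X k w))).
  by apply: eq_Rintegral => w _; rewrite symH.
rewrite (freezing X X_iid j
    (fun xw => H (xw.1, X i xw.2) * H (X i xw.2, X k xw.2))); last first.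
  apply: bmeasM; first exact: bmeas_frozen_left.
  exact: (bmeas_frozen_right j (fun w => H (X i w, X k w))
    (bmeas_others2 H j i k bH ij kj)).
transitivity (\int[P]_w (H (X k w, X i w) * g0 (X i w))).
  apply: eq_Rintegral => w _ /=.
  under eq_Rintegral do rewrite mulrC.
  by rewrite expectZ; [rewrite symH|exact: bmeas_slice bH (X i w)].
have bgi : bounded_measurable (fun w : others X k => g0 (X i w)).
  have [mg [M gM]] := bmeas_kernel_section; split; last by exists M.
  by apply: measurableT_comp mg _; exact: measurable_others.
rewrite (freezing X X_iid k (fun xw => H (xw.1, X i xw.2) * g0 (X i xw.2))); last first.
  apply: bmeasM; first exact: bmeas_frozen_left.
  exact: (bmeas_frozen_right k (fun w => g0 (X i w))).
have bg2 := bmeas_sqr _ bmeas_kernel_section.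
rewrite -(expect_law X i _ X_iid bg2).
apply: eq_Rintegral => w _ /=.
under eq_Rintegral do rewrite mulrC.
by rewrite expectZ; [rewrite expr2|exact: bmeas_slice bH (X i w)].
Qed.

(** The influence function of one observation on the U-statistic.  The factor 2
is the degree: an observation enters a pair as its first or as its second
element. *)
Definition hajek (y : Omega) : R := 2 * (g0 y - th).

Lemma bmeas_hajek : bounded_measurable hajek.
Proof.
apply: bmeasZ; apply: bmeasB; last exact: bmeas_cst.
exact: bmeas_kernel_section.
Qed.

Lemma expect_hajek : \int[F]_y hajek y = 0.
Proof.
rewrite expectZ; last first.
  by apply: bmeasB; [exact: bmeas_kernel_section|exact: bmeas_cst].
rewrite expectB; [|exact: bmeas_kernel_section|exact: bmeas_cst].
by rewrite (expect_cst F) subrr mulr0.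
Qed.

Lemma expect_hajek2 :
  \int[F]_y (hajek y ^+ 2) = 4 * (\int[F]_y (g0 y ^+ 2) - th ^+ 2).
Proof.
have bg := bmeas_kernel_section.
have bg2 := bmeas_sqr _ bg.
transitivity (\int[F]_y (4 * (g0 y ^+ 2) - (8 * th * g0 y - 4 * th ^+ 2))).
  by apply: eq_Rintegral => y _; rewrite /hajek; ring.
have b1 := bmeasZ 4 _ bg2. have b2 := bmeasZ (8 * th) _ bg.
have b3 := @bmeas_cst _ Omega R (4 * th ^+ 2).
rewrite expectB//; last exact: bmeasB.
rewrite expectB// (expectZ F 4 _ bg2) (expectZ F (8 * th) _ bg) (expect_cst F) -/th.
by ring.
Qed.

(** The completely degenerate part of the kernel: integrating out either argument
gives 0. *)
Definition residual (z : Omega * Omega) : R :=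
  H z - th - (g0 z.1 - th) - (g0 z.2 - th).

Lemma bmeas_residual : bounded_measurable residual.
Proof.
have [mg [M gM]] := bmeas_kernel_section.
have b1 : bounded_measurable (fun z : Omega * Omega => g0 z.1).
  by split; [exact: measurableT_comp mg _|exists M].
have b2 : bounded_measurable (fun z : Omega * Omega => g0 z.2).
  by split; [exact: measurableT_comp mg _|exists M].
have b0 := @bmeas_cst _ (Omega * Omega)%type R th.
by apply: bmeasB; [apply: bmeasB; exact: bmeasB|exact: bmeasB].
Qed.

Lemma residual_sym x y : residual (x, y) = residual (y, x).
Proof. by rewrite /residual/= symH; ring. Qed.

Lemma expect_residual y : \int[F]_x residual (x, y) = 0.
Proof.
have bg := bmeas_kernel_section.
have bs := bmeas_slice H bH y.
have b0 := @bmeas_cst _ Omega R th.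
have b1 := @bmeas_cst _ Omega R (g0 y - th).
rewrite /residual/= expectB//; last by apply: bmeasB; exact: bmeasB.
rewrite expectB//; [|exact: bmeasB|exact: bmeasB].
rewrite (expectB F _ _ bs b0) (expectB F _ _ bg b0) !(expect_cst F).
by rewrite -/(g0 y) -/th subrr subr0 subrr.
Qed.

(** Integrating out [X i], which occurs in the first factor only, makes that
factor vanish. *)
Lemma residual_orthogonal i j k l : j != i -> k != i -> l != i ->
  \int[P]_w (residual (X i w, X j w) * residual (X k w, X l w)) = 0.
Proof.
move=> ji ki li; have br := bmeas_residual.
rewrite (freezing X X_iid i
    (fun xw => residual (xw.1, X j xw.2) * residual (X k xw.2, X l xw.2))); last first.
  apply: bmeasM; first exact: bmeas_frozen_left.
  exact: (bmeas_frozen_right i (fun w => residual (X k w, X l w))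
    (bmeas_others2 _ i k l br ki li)).
transitivity (\int[P]_w (0 : R)); last exact: expect_cst.
apply: eq_Rintegral => w _ /=.
under eq_Rintegral do rewrite mulrC.
by rewrite expectZ ?expect_residual ?mulr0//; exact: bmeas_slice br (X j w).
Qed.

(** Two different unordered pairs differ by an index that belongs to the first
one only; by symmetry of the residual it may be taken to be its first entry. *)
Lemma residual_uncorrelated n (p q : 'I_n * 'I_n) : p.1 != p.2 ->
  q != p -> q != (p.2, p.1) -> q.1 != q.2 ->
  \int[P]_w (residual (X p.1 w, X p.2 w) * residual (X q.1 w, X q.2 w)) = 0.
Proof.
case: p q => [i j] [k l]/= ij; rewrite !xpair_eqE => n1 n2 kl.
have ji : j != i by rewrite eq_sym.
have [/andP[ki li]|] := boolP ((k != i) && (l != i)).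
  exact: residual_orthogonal.
rewrite negb_and !negbK => kli.
have [kj lj] : k != j /\ l != j.
  split; apply/eqP => e.
    move: n2; rewrite e eqxx /= => li; move: kli; rewrite e (negbTE ji) (negbTE li).
    by [].
  move: n1; rewrite e eqxx andbT => ki; move: kli; rewrite e (negbTE ji) (negbTE ki).
  by [].
transitivity (\int[P]_w (residual (X j w, X i w) * residual (X k w, X l w))).
  by apply: eq_Rintegral => w _; rewrite residual_sym.
exact: residual_orthogonal.
Qed.

(** Among the products of two residual terms, only those of a pair with itself or
with its reversal contribute: at most 2 n^2 bounded terms. *)
Lemma residual_sum_second_moment : exists2 B, 0 <= B & forall n,
  \int[P]_w ((\sum_(p : 'I_n * 'I_n | p.1 != p.2)
      residual (X p.1 w, X p.2 w)) ^+ 2) <= B * n%:R ^+ 2.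
Proof.
have [mr [M rM]] := bmeas_residual.
have M0 : 0 <= M by rewrite (le_trans _ (rM point)).
exists (2 * M ^+ 2) => [|n]; first by rewrite mulr_ge0// sqr_ge0.
pose r (p : 'I_n * 'I_n) w := residual (X p.1 w, X p.2 w).
have br p : bounded_measurable (r p).
  by apply: bmeas_pair; exact: bmeas_residual.
have -> : \int[P]_w ((\sum_(p : 'I_n * 'I_n | p.1 != p.2) r p w) ^+ 2) =
    \int[P]_w \sum_(p : 'I_n * 'I_n | p.1 != p.2)
      \sum_(q : 'I_n * 'I_n | q.1 != q.2) (r p w * r q w).
  apply: eq_Rintegral => w _; rewrite expr2 mulr_suml.
  by apply: eq_bigr => p _; rewrite mulr_sumr.
rewrite expect_sum; last first.
  by move=> p _; apply: bmeas_sum => q _; exact: bmeasM.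
apply: (@le_trans _ _ (\sum_(p : 'I_n * 'I_n) (2 * M ^+ 2))); last first.
  by rewrite sumr_const card_prod !card_ord -[leLHS]mulr_natr natrM -expr2.
rewrite big_mkcond/=; apply: ler_sum => p _; case: ifPn => p12; last first.
  by rewrite mulr_ge0// sqr_ge0.
rewrite expect_sum; last by move=> q _; exact: bmeasM.
apply: (@le_trans _ _ (\sum_(q : 'I_n * 'I_n)
    (M ^+ 2 * (q == p)%:R + M ^+ 2 * (q == (p.2, p.1))%:R))); last first.
  rewrite big_split/= -!mulr_sumr.
  have one (a : 'I_n * 'I_n) : \sum_(q : 'I_n * 'I_n) (q == a)%:R = 1 :> R.
    rewrite (bigD1 a)//= eqxx big1 ?addr0// => q /negbTE ->; by [].
  by rewrite !one mulr1 -mulr2n mulr_natl.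
rewrite big_mkcond/=; apply: ler_sum => q _.
have ind b : 0 <= M ^+ 2 * b%:R by rewrite mulr_ge0// sqr_ge0.
case: ifPn => q12; last by rewrite addr_ge0.
have cs : \int[P]_w (r p w * r q w) <= M ^+ 2.
  rewrite -(expect_cst P (M ^+ 2)).
  apply: expect_le; [exact: bmeasM|exact: bmeas_cst|].
  move=> w; rewrite (le_trans (ler_norm _))// normrM expr2 ler_pM//; exact: rM.
have [qp|qp] := eqVneq q p.
  by rewrite mulr1 (le_trans cs)// lerDl.
have [qs|qs] := eqVneq q (p.2, p.1).
  by rewrite mulr0 mulr1 add0r.
by rewrite !mulr0 addr0 /r residual_uncorrelated.
Qed.

End Hoeffding.

Section UstatisticCLT.
Context {d d'} {T : measurableType d} {Omega : measurableType d'} {R : realType}.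
Context {P : probability T R} {F : probability Omega R}.
Variables (X : nat -> {RV P >-> Omega}).
Hypothesis X_iid : iid X F.
Variable H : Omega * Omega -> R.
Hypothesis bH : bounded_measurable H.
Hypothesis symH : forall x y, H (x, y) = H (y, x).
Local Notation th := (@kernel_mean _ _ R F H).
Local Notation g0 := (@kernel_section _ _ R F H).
Local Notation res := (@residual _ _ R F H).
Local Notation hj := (@hajek _ _ R F H).

Definition pair_average n (w : T) : R := (n%:R * (n%:R - 1))^-1 *
  \sum_(p : 'I_n * 'I_n | p.1 != p.2) H (X p.1 w, X p.2 w).

Lemma bmeas_pair_average n : bounded_measurable (pair_average n).
Proof.
apply: bmeasZ; apply: bmeas_sum => p _.
exact: (bmeas_pair X H p.1 p.2 bH).
Qed.

Lemma natr_pred n : (0 < n)%N -> n.-1%:R = n%:R - 1 :> R.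
Proof. by case: n => // n _; rewrite -natr1 addrK. Qed.

Lemma expect_pair_average n : (2 <= n)%N -> \int[P]_w pair_average n w = th.
Proof.
move=> n2; have n0 : (0 < n)%N by exact: (ltnW n2).
have D0 : n%:R * (n%:R - 1) != 0 :> R.
  by rewrite mulf_neq0 ?pnatr_eq0 -?lt0n// -natr_pred// pnatr_eq0 -lt0n -ltnS prednK.
rewrite expectZ; last first.
  by apply: bmeas_sum => p _; exact: (bmeas_pair X H p.1 p.2 bH).
rewrite expect_sum; last by move=> p _; exact: (bmeas_pair X H p.1 p.2 bH).
under eq_bigr => p pp do rewrite (expect_kernel X X_iid H bH)//.
rewrite (sum_offdiag n (fun=> th)) sumr_const card_ord -mulrnA -[X in _ * X]mulr_natr.
by rewrite natrM natr_pred// mulrCA mulVf// mulr1.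
Qed.

(** Summing H = residual + th + (g0 - th) + (g0 - th) over the ordered pairs, each
index occurs n - 1 times as a first and n - 1 times as a second entry; hence
the linear part 2 (n - 1) / (n (n - 1)) times the sum of g0 - th. *)
Lemma hoeffding_decomposition n (w : T) : (2 <= n)%N ->
  Num.sqrt n%:R * (pair_average n w - th)
    - (\sum_(k < n) hj (X k w)) / Num.sqrt n%:R =
  Num.sqrt n%:R / (n%:R * (n%:R - 1)) *
    \sum_(p : 'I_n * 'I_n | p.1 != p.2) res (X p.1 w, X p.2 w).
Proof.
move=> n2; have n0 : (0 < n)%N by exact: (ltnW n2).
have nR : 0 < n%:R :> R by rewrite ltr0n.
have n1R : 0 < n%:R - 1 :> R by rewrite -natr_pred// ltr0n -ltnS prednK.
set q := Num.sqrt n%:R; have q0 : 0 < q by rewrite sqrtr_gt0.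
have qq : q ^+ 2 = n%:R by rewrite sqr_sqrtr// ltW.
pose G := \sum_(k < n) (g0 (X k w) - th).
have -> : \sum_(k < n) hj (X k w) = 2 * G by rewrite mulr_sumr.
pose D : R := n%:R * (n%:R - 1).
have -> : pair_average n w = D^-1 *
    (\sum_(p : 'I_n * 'I_n | p.1 != p.2) res (X p.1 w, X p.2 w)
      + D * th + 2 * (n%:R - 1) * G).
  congr (_ * _).
  transitivity (\sum_(p : 'I_n * 'I_n | p.1 != p.2) res (X p.1 w, X p.2 w)
      + \sum_(p : 'I_n * 'I_n | p.1 != p.2) th
      + (\sum_(p : 'I_n * 'I_n | p.1 != p.2) (g0 (X p.1 w) - th)
        + \sum_(p : 'I_n * 'I_n | p.1 != p.2) (g0 (X p.2 w) - th))).
    rewrite -!big_split/=.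
    by apply: eq_bigr => p _; rewrite /residual/=; ring.
  rewrite -!addrA; congr (_ + (_ + _)).
    rewrite (sum_offdiag n (fun=> th)) sumr_const card_ord -mulrnA -[LHS]mulr_natr.
    by rewrite natrM natr_pred// mulrC.
  rewrite (sum_offdiag_swap n (fun i _ => g0 (X i w) - th)).
  rewrite (sum_offdiag n (fun i => g0 (X i w) - th)) -/G.
  by rewrite -(mulr_natr G) natr_pred//; ring.
rewrite /D -qq in n1R *; field; rewrite !gt_eqF//.
Qed.

(** The second moment of the remainder is at most
n / (n (n - 1))^2 * B n^2 = B n / (n - 1)^2, which is O(1 / n). *)
Theorem ustat2_clt (s : R) : 0 < s ->
  s ^+ 2 = 4 * (\int[F]_y (g0 y ^+ 2) - th ^+ 2) ->
  cvg_in_law P (fun n w => Num.sqrt n%:R * (pair_average n w - th)) (normal_prob 0 s).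
Proof.
move=> s0 s2; have [B B0 res2] := residual_sum_second_moment X X_iid H bH symH.
apply: (clt_remainder X hj s _ (4 * B) X_iid (bmeas_hajek H bH) s0).
- exact: expect_hajek.
- by rewrite expect_hajek2.
- move=> n; apply: bmeasZ; apply: bmeasB; last exact: bmeas_cst.
  exact: bmeas_pair_average.
near=> n.
have n2 : (2 <= n)%N by near: n; exact: nbhs_infty_ge.
have n0 : (0 < n)%N by exact: (ltnW n2).
have nR : 0 < n%:R :> R by rewrite ltr0n.
have nR2 : 2 <= n%:R :> R by rewrite ler_nat.
under eq_Rintegral do rewrite hoeffding_decomposition// exprMn.
have br (p : 'I_n * 'I_n) : bounded_measurable (fun w => res (X p.1 w, X p.2 w)).
  by apply: bmeas_pair; exact: bmeas_residual.
rewrite expectZ; last by apply: bmeas_sqr; apply: bmeas_sum => p _; exact: br.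
rewrite (le_trans (ler_wpM2l _ (res2 n))) ?sqr_ge0//.
have D0 : 0 < n%:R - 1 :> R by rewrite subr_gt0 ltr1n.
have -> : (Num.sqrt n%:R / (n%:R * (n%:R - 1))) ^+ 2 * (B * n%:R ^+ 2) =
    B * n%:R / (n%:R - 1) ^+ 2.
  by rewrite exprMn sqr_sqrtr ?(ltW nR)//; field; rewrite !gt_eqF.
rewrite ler_pdivrMr ?exprn_gt0// mulrAC ler_pdivlMr//.
have -> : B * n%:R * n%:R = B * n%:R ^+ 2 :> R by ring.
have -> : 4 * B * (n%:R - 1) ^+ 2 = B * (2 * (n%:R - 1)) ^+ 2 :> R by ring.
by rewrite ler_wpM2l// lerXn2r ?nnegrE//; lra.
Unshelve. all: by end_near. Qed.

End UstatisticCLT.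

(** * The reflexivity graph *)

Lemma set2_ltn_inj n (i j k l : 'I_n) : (i < j)%N -> (k < l)%N ->
  [set i; j]%SET = [set k; l]%SET -> (i, j) = (k, l).
Proof.
move=> ij kl /setP e.
have /esym := e i; rewrite !inE eqxx /= => /orP[/eqP ik|/eqP il].
  have := e j; rewrite !inE eqxx orbT /= ik => /esym/orP[/eqP jk|/eqP ->//].
  by move: ij; rewrite ik jk ltnn.
have /esym := e k; rewrite !inE eqxx /= => /eqP; rewrite -il => /esym/eqP.
by case/orP => /eqP h; move: kl; rewrite h -?il ?ltnn// => /(ltn_trans ij); rewrite ?ltnn.
Qed.

(** Each edge, a two-element set, is listed once by its increasing enumeration. *)
Lemma card_and_edges n (e : rel 'I_n) :
  #|and_edges e| =
  #|[set p : 'I_n * 'I_n | (p.1 < p.2)%N && (e p.1 p.2 && e p.2 p.1)]%SET|.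
Proof.
rewrite -(@card_in_imset _ _ (fun p : 'I_n * 'I_n => [set p.1; p.2]%SET)); last first.
  move=> [i j] [k l]; rewrite !inE/= => /andP[ij _] /andP[kl _].
  exact: set2_ltn_inj.
apply: eq_card => A; rewrite inE; apply/existsP/imsetP.
  move=> [i /existsP[j /and4P[ij /eqP -> eij eji]]].
  have [lt|gt|eq] := ltngtP i j.
  - by exists (i, j) => //; rewrite inE/= lt eij.
  - by exists (j, i); [rewrite inE/= gt eij eji|rewrite finset.setUC].
  - by move: ij; rewrite (val_inj eq) eqxx.
move=> [[i j]]; rewrite inE/= => /and3P[ij eij eji ->].
exists i; apply/existsP; exists j.
by rewrite eqxx eij eji andbT /= andbT; apply: contraTneq ij => ->; rewrite ltnn.
Qed.

Lemma sum_offdiag_sym {V : zmodType} n (f : 'I_n -> 'I_n -> V) :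
  (forall i j, f i j = f j i) ->
  \sum_(p : 'I_n * 'I_n | p.1 != p.2) f p.1 p.2 =
  (\sum_(p : 'I_n * 'I_n | (p.1 < p.2)%N) f p.1 p.2) *+ 2.
Proof.
move=> fC; rewrite (bigID (fun p : 'I_n * 'I_n => (p.1 < p.2)%N))/= mulr2n.
congr (_ + _).
  apply: eq_bigl => p; case: ltngtP => [lt|gt|eq]; rewrite ?andbF ?andbT//.
  by apply: contraTneq lt => ->; rewrite ltnn.
rewrite (reindex_inj (h := fun p : 'I_n * 'I_n => (p.2, p.1))) /=; last first.
  by move=> [a b] [a' b'] [-> ->].
apply: eq_big => [p|p _]; last exact: fC.
by rewrite -leqNgt ltn_neqAle eq_sym.
Qed.

Lemma sum_sorted_pairs {V : zmodType} n (f : 2.-tuple 'I_n -> V) :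
  \sum_(c : 2.-tuple 'I_n | sorted ltn (map val c)) f c =
  \sum_(p : 'I_n * 'I_n | (p.1 < p.2)%N) f [tuple p.1; p.2].
Proof.
rewrite (reindex (fun p : 'I_n * 'I_n => [tuple p.1; p.2])) /=.
  by apply: eq_bigl => p; rewrite andbT.
exists (fun c => (tnth c ord0, tnth c ord_max)) => [[i j] _|c _] //=.
apply: eq_from_tnth => k.
by case: k => [[|[|//]] k2]; rewrite (tnth_nth (tnth c ord0))/=;
   congr tnth; exact/val_inj.
Qed.

Section AndGraph.
Context {d d'} {T : measurableType d} {Omega : measurableType d'} {R : realType}.
Context {P : probability T R}.
Variables (X : nat -> {RV P >-> Omega}) (N : proximity_map Omega).
Hypothesis mN : measurable [set z : Omega * Omega | N z.1 z.2].

Definition mutual_proximity : set (Omega * Omega) :=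
  [set z | N z.1 z.2 /\ N z.2 z.1].

Definition and_kernel (z : Omega * Omega) : R := \1_mutual_proximity z.

Lemma measurable_mutual_proximity : measurable mutual_proximity.
Proof.
apply: measurableI => //.
have := @measurable_swap _ _ Omega Omega measurableT _ mN.
by rewrite setTI.
Qed.

Lemma bmeas_and_kernel : bounded_measurable and_kernel.
Proof. by apply: bmeas_indic; exact: measurable_mutual_proximity. Qed.

Lemma and_kernel_sym x y : and_kernel (x, y) = and_kernel (y, x).
Proof.
rewrite /and_kernel !indicE; congr (_ %:R); congr nat_of_bool.
by apply/idP/idP; rewrite !inE => -[].
Qed.

Lemma h_andE i j w : h_and X N i j w = and_kernel (X i w, X j w).
Proof. by rewrite /h_and /and_kernel !indicE. Qed.

Lemma p_andE i j : p_and X N i j = \int[P]_w and_kernel (X i w, X j w).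
Proof.
rewrite /p_and /Rintegral; congr fine.
have -> : (fun w => (and_kernel (X i w, X j w))%:E) =
    (fun w => (\1_[set w | (N (X i w) `&` Gamma1 N (X i w)) (X j w)] w)%:E).
  by apply/funext => w; congr EFin; rewrite -h_andE /h_and !indicE.
rewrite integral_indic ?setIT//.
have mp : measurable_fun setT (fun w => (X i w, X j w)) by exact: measurable_fun_pair.
by have := mp measurableT _ measurable_mutual_proximity; rewrite setTI.
Qed.

Lemma rho_and_pairs n w : rho_and X N n w =
  2 / (n%:R * (n%:R - 1)) *
    \sum_(p : 'I_n * 'I_n | (p.1 < p.2)%N) and_kernel (X p.1 w, X p.2 w).
Proof.
rewrite /rho_and /rel_edge_density card_and_edges -sum1_card natr_sum.
rewrite mulrAC; congr (_ * _).
rewrite [LHS]big_mkcond [RHS]big_mkcond/=; apply: eq_bigr => -[i j] _.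
rewrite inE/= /and_kernel indicE /pcd.
have [ij|//] := boolP (i < j)%N.
have [-> ->] : i != j /\ j != i.
  by split; apply: contraTneq ij => ->; rewrite ltnn.
have [a|a] := boolP (_ \in mutual_proximity).
  by move: a; rewrite inE => -[/= /asboolP -> /asboolP ->].
case: ifPn => //= /andP[/asboolP nij /asboolP nji].
by case/negP: a; rewrite inE; exact: conj nij nji.
Qed.

Lemma rho_and_average n w : rho_and X N n w = pair_average X and_kernel n w.
Proof.
rewrite rho_and_pairs /pair_average.
rewrite (sum_offdiag_sym n (fun i j => and_kernel (X i w, X j w))).
  by rewrite -mulr_natr; ring.
by move=> i j; exact: and_kernel_sym.
Qed.

(** The U-statistic sums over increasing pairs, as does [rho_and_pairs]; the
normalizations agree because n (n - 1) = 2 'C(n, 2). *)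
Lemma rho_and_Ustatistic : one_sample_Ustatistic X 2 (rho_and X N).
Proof.
exists (fun t : 2.-tuple Omega => and_kernel (tnth t ord0, tnth t ord_max)).
have [mk [M kM]] := bmeas_and_kernel.
have mg : measurable_fun setT
    (fun t : 2.-tuple Omega => and_kernel (tnth t ord0, tnth t ord_max)).
  by apply: measurableT_comp mk _; apply: measurable_fun_pair; exact: measurable_tnth.
split=> //.
- move=> s t; rewrite !tnth_mktuple.
  have : s ord0 != s ord_max by rewrite (inj_eq perm_inj).
  have ord2 (a : 'I_2) : a = ord0 \/ a = ord_max.
    by case: a => [[|[|//]] a2]; [left|right]; exact: val_inj.
  have [->|->] := ord2 (s ord0); have [->|->] := ord2 (s ord_max); rewrite ?eqxx// => _.
  exact: and_kernel_sym.
- apply: bmeas_integrable; under eq_fun do rewrite !tnth_mktuple.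
  exact: (bmeas_pair X and_kernel 0%N 1%N bmeas_and_kernel).
- move=> n w n2; rewrite rho_and_pairs /Ustat sum_sorted_pairs.
  congr (_ * _).
  have n0 : (0 < n)%N by exact: (ltnW n2).
  have C0 : 'C(n, 2)%:R != 0 :> R by rewrite pnatr_eq0 -lt0n bin_gt0.
  have -> : n%:R * (n%:R - 1) = 'C(n, 2)%:R * 2 :> R.
    by rewrite -natr_pred// -!natrM (bin_ffact n 2) ffactnS ffactn1.
  by field.
Qed.

Lemma fine_expectation (f : T -> R) : fine 'E_P[f]%E = \int[P]_w f w.
Proof. by rewrite unlock. Qed.

End AndGraph.

Theorem corollary3p2 (d d' : measure_display) (T : measurableType d)
    (Omega : measurableType d') (R : realType) (P : probability T R)
    (F : probability Omega R) (X : nat -> {RV P >-> Omega})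
    (N : proximity_map Omega)
    (mN : measurable [set z : Omega * Omega | N z.1 z.2])
    (X_iid : iid X F) :
  [/\ one_sample_Ustatistic X 2 (rho_and X N),
      forall n i j : nat, (2 <= n)%N -> i != j ->
        ('E_P[rho_and X N n] = (p_and X N i j)%:E)%E
    & (forall i j k : nat, uniq [:: i; j; k] -> 0 < nu_and X N i j k) ->
      forall i j k : nat, uniq [:: i; j; k] ->
        cvg_in_law P
          (fun n w => Num.sqrt n%:R * (rho_and X N n w - p_and X N i j))
          (normal_prob 0 (Num.sqrt (4 * nu_and X N i j k)))].
Proof.
have bH := @bmeas_and_kernel _ Omega R N mN.
have symH := @and_kernel_sym _ Omega R N.
pose th := @kernel_mean _ _ R F (and_kernel N).
have pE i j : i != j -> p_and X N i j = th.
  by move=> ij; rewrite p_andE//; exact: expect_kernel.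
have rhoE n : rho_and X N n = pair_average X (and_kernel N) n.
  by apply/funext => w; exact: rho_and_average.
have nuE i j k : uniq [:: i; j; k] -> nu_and X N i j k =
    \int[F]_y (@kernel_section _ _ R F (and_kernel N) y ^+ 2) - th ^+ 2.
  move=> ijk; have := ijk; rewrite /= !inE negb_or => /andP[/andP[ij ik] _].
  have hE a b : h_and X N a b = (fun w => and_kernel N (X a w, X b w)).
    by apply/funext => w; exact: h_andE.
  rewrite /nu_and unlock fine_expectation !fine_expectation !hE.
  rewrite !(expect_kernel X X_iid _ bH)// -/th.
  have bij := bmeas_pair X (and_kernel N) i j bH.
  have bik := bmeas_pair X (and_kernel N) i k bH.
  rewrite -(expect_kernel2 X X_iid _ bH symH _ _ _ ijk).
  pose Hij w : R := and_kernel N (X i w, X j w).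
  pose Hik w : R := and_kernel N (X i w, X k w).
  (* The covariance is E[h_ij h_ik] - th^2, and conditioning on X i identifies
     the first term. *)
  transitivity (\int[P]_w (Hij w * Hik w - (th * Hij w + (th * Hik w - th ^+ 2)))).
    by apply: eq_Rintegral => w _; rewrite /Hij /Hik !fctE /=; ring.
  have b1 := bmeasZ th _ bij. have b2 := bmeasZ th _ bik.
  have b3 := @bmeas_cst _ T R (th ^+ 2).
  rewrite (expectB P _ _ (bmeasM _ _ bij bik) (bmeasD _ _ b1 (bmeasB _ _ b2 b3))).
  rewrite (expectD P _ _ b1 (bmeasB _ _ b2 b3)) (expectB P _ _ b2 b3).
  rewrite (expectZ P th _ bij) (expectZ P th _ bik) (expect_cst P).
  by rewrite !(expect_kernel X X_iid _ bH)// -/th; ring.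
split.
- exact: rho_and_Ustatistic.
- move=> n i j n2 ij; rewrite rhoE pE// unlock.
  rewrite EFin_expect; last exact: bmeas_pair_average.
  by rewrite (expect_pair_average X X_iid).
- move=> nu0 i j k ijk; have := nu0 i j k ijk => nupos.
  have s0 : 0 < Num.sqrt (4 * nu_and X N i j k) by rewrite sqrtr_gt0 mulr_gt0.
  have s2 : Num.sqrt (4 * nu_and X N i j k) ^+ 2 = 4 * nu_and X N i j k.
    by rewrite sqr_sqrtr// mulr_ge0// ltW.
  have := ijk; rewrite /= !inE negb_or => /andP[/andP[ij ik] _].
  rewrite pE//.
  have := ustat2_clt X X_iid (and_kernel N) bH symH _ s0.
  rewrite s2 nuE// => /(_ erefl); congr cvg_in_law.
  by apply/funext => n; apply/funext => w; rewrite rhoE.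
Qed.
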